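(* Let $n\in\mathbb N$ and let $\widehat{\mathcal F}$ be the integral transform which associates with $f\in L_1$ the $\bigotimes C^{n+1}$-valued function of $(\omega_0,\ldots,\omega_n)\in\mathbb R^{n+1}$ $$\widehat{\mathcal F}f(\widehat\omega)=\int_{-\infty}^{\infty}f(t)e^{-\widehat\omega t}\,dt,\qquad \widehat\omega=\sum_{k=0}^{n}\omega_k i_k .$$ Then $\widehat{\mathcal F}$ is $\mathbb R$-linear and injective, and satisfies $$\widehat{\mathcal F}(f^{(k)})=\widehat\omega^{\,k}\,\widehat{\mathcal F}f,\qquad k\in\mathbb N,$$ for $f,f^{(k)}\in L_1$, as well as $$\widehat{\mathcal F}(f*g)=\widehat{\mathcal F}f\cdot\widehat{\mathcal F}g,\qquad f,g\in L_1 .$$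
   Context: $L_1=L_1(\mathbb R)$ is the space of real-valued Lebesgue integrable functions on $\mathbb R$ (functions equal almost everywhere being identified), and $*$ is the usual convolution on $\mathbb R$. $\bigotimes C^{n+1}$ is the tensor product over $\mathbb R$ of $n+1$ copies of the complex field: the commutative, associative, unital real algebra of dimension $2^{n+1}$ generated by $i_0,\ldots,i_n$ with $i_k^2=-1$, having basis $i_0^{p_0}\cdots i_n^{p_n}$, $p_k\in\{0,1\}$. The exponential in the algebra is given by the usual power series, and the integral is taken componentwise in a real basis. In the derivative formula, $f$ is assumed $k$ times differentiable. *)

(* Defs.v *)
From HB Require Import structures.
From mathcomp Require Import all_boot all_order all_algebra.
From mathcomp Require Import all_classical all_reals all_analysis.

Set Implicit Arguments.
Unset Strict Implicit.
Unset Printing Implicit Defensive.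

Import Order.TTheory GRing.Theory Num.Theory.
Import numFieldNormedType.Exports.

Local Open Scope classical_set_scope.
Local Open Scope ring_scope.

(* Exponents (p_0, ..., p_n) with p_k in {0, 1}. *)
Notation expo n := {ffun 'I_n.+1 -> bool} (only parsing).

(* The tensor product over R of n+1 copies of C.  The value at p is the
   coordinate on the basis monomial i_0^{p_0} ... i_n^{p_n}. *)
Definition tensC (R : realType) (n : nat) : Type := {ffun expo n -> R}.

Section TensorAlgebra.
Context {R : realType} {n : nat}.
Local Notation T := (tensC R n).
Local Notation I := (expo n).
Implicit Types (x y z : T) (p q r s : I).

HB.instance Definition _ := GRing.Lmodule.on T.
HB.instance Definition _ := Vector.on T.

Definition tbasis p : T := [ffun q => (q == p)%:R].

Definition expo0 : I := [ffun=> false].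
Definition expo1 (k : 'I_n.+1) : I := [ffun j => j == k].
Definition addx p q : I := [ffun k => p k (+) q k].

Fact addxA : associative addx.
Proof. by move=> p q r; apply/ffunP => k; rewrite !ffunE addbA. Qed.

Fact addxC : commutative addx.
Proof. by move=> p q; apply/ffunP => k; rewrite !ffunE addbC. Qed.

Fact add0x : left_id expo0 addx.
Proof. by move=> p; apply/ffunP => k; rewrite !ffunE. Qed.

(* As i_k ^ 2 = -1 and the generators commute, the product of the monomials
   with exponents p and q is tsign p q times the one with exponent addx p q. *)
Definition tsign p q : R := \prod_k (-1) ^+ (p k && q k).

Definition tmul x y : T :=
  [ffun r => \sum_p \sum_(q | addx p q == r) tsign p q * x p * y q].

Fact tsignC p q : tsign p q = tsign q p.
Proof. by apply: eq_bigr => k _; rewrite andbC. Qed.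

Fact tsignA p q r :
  tsign p q * tsign (addx p q) r = tsign q r * tsign p (addx q r).
Proof.
rewrite /tsign -!big_split; apply: eq_bigr => k _ /=; rewrite !ffunE -!signr_addb.
by case: (p k); case: (q k); case: (r k).
Qed.

Fact tmulC : commutative tmul.
Proof.
move=> x y; apply/ffunP => r; rewrite !ffunE.
under eq_bigr do rewrite big_mkcond /=.
rewrite exchange_big /=; apply: eq_bigr => q _.
rewrite [RHS]big_mkcond /=; apply: eq_bigr => p _.
by rewrite addxC tsignC mulrAC.
Qed.

Fact tmulA : associative tmul.
Proof.
have sum_addx (p q : I) (F : I -> R) :
    F (addx p q) = \sum_r (if addx p q == r then F r else 0).
  rewrite (bigD1 (addx p q)) //= eqxx big1 ?addr0 // => r /negbTE.
  by rewrite eq_sym => ->.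
move=> x y z; apply/ffunP => s; rewrite !ffunE.
pose G p q r := if addx (addx p q) r == s
  then tsign p q * tsign (addx p q) r * x p * y q * z r else 0.
transitivity (\sum_p \sum_q \sum_r G p q r).
  apply: eq_bigr => p _.
  transitivity (\sum_q \sum_r \sum_u (if addx q r == u then
     (if addx p u == s then tsign q r * tsign p u * x p * y q * z r else 0)
     else 0)).
    rewrite big_mkcond /=.
    under [RHS]eq_bigr do rewrite exchange_big /=.
    rewrite [RHS]exchange_big /=; apply: eq_bigr => u _.
    under [RHS]eq_bigr do rewrite -big_mkcond /=.
    case: ifP => _; last by rewrite big1 // => q _; rewrite big1.
    rewrite ffunE mulr_sumr; apply: eq_bigr => q _.
    rewrite mulr_sumr; apply: eq_bigr => r _.
    by rewrite !mulrA; congr (_ * _ * _); rewrite mulrC !mulrA.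
  apply: eq_bigr => q _; apply: eq_bigr => r _.
  pose F u := if addx p u == s
    then tsign q r * tsign p u * x p * y q * z r else 0.
  by rewrite -(sum_addx q r F) /F /G addxA tsignA.
transitivity (\sum_p \sum_q \sum_r \sum_u (if addx p q == u then
   (if addx u r == s then tsign p q * tsign u r * x p * y q * z r else 0)
   else 0)).
  apply: eq_bigr => p _; apply: eq_bigr => q _; apply: eq_bigr => r _.
  pose F u := if addx u r == s
    then tsign p q * tsign u r * x p * y q * z r else 0.
  by rewrite -(sum_addx p q F).
under eq_bigr do (under eq_bigr do rewrite exchange_big /=;
  rewrite exchange_big /=).
rewrite exchange_big /=; apply: eq_bigr => u _.
under eq_bigr do rewrite exchange_big /=.
rewrite exchange_big /= [RHS]big_mkcond /=; apply: eq_bigr => r _.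
under eq_bigr do rewrite -big_mkcond /=.
case: ifP => _; last by rewrite big1 // => p _; rewrite big1.
rewrite ffunE mulr_sumr mulr_suml; apply: eq_bigr => p _.
rewrite mulr_sumr mulr_suml; apply: eq_bigr => q _.
by rewrite !mulrA; congr (_ * _ * _ * _); rewrite mulrC.
Qed.

Fact tmul1 : left_id (tbasis expo0) tmul.
Proof.
move=> x; apply/ffunP => r.
rewrite !ffunE (bigD1 expo0) //= [X in _ + X]big1 ?addr0.
  under eq_bigl do rewrite add0x.
  rewrite big_pred1_eq ffunE eqxx mulr1 /tsign big1 ?mul1r // => k _.
  by rewrite ffunE.
by move=> p /negbTE p0; rewrite big1 // => q _; rewrite ffunE p0 mulr0 mul0r.
Qed.

Fact tmulDl : left_distributive tmul +%R.
Proof.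
move=> x y z; apply/ffunP => r.
rewrite !ffunE -big_split; apply: eq_bigr => p _.
by rewrite -big_split; apply: eq_bigr => q _ /=; rewrite ffunE mulrDr mulrDl.
Qed.

Fact tone_neq0 : tbasis expo0 != 0.
Proof.
by apply/eqP => /ffunP /(_ expo0) /eqP; rewrite !ffunE eqxx oner_eq0.
Qed.

HB.instance Definition _ :=
  GRing.Zmodule_isComNzRing.Build T tmulA tmulC tmul1 tmulDl tone_neq0.

Fact tscaleAl (a : R) x y : a *: (x * y) = (a *: x) * y.
Proof.
apply/ffunP => r; rewrite !ffunE scaler_sumr; apply: eq_bigr => p _.
rewrite scaler_sumr; apply: eq_bigr => q _.
by rewrite ffunE /GRing.scale /= !mulrA; congr (_ * _ * _); rewrite mulrC.
Qed.

HB.instance Definition _ := GRing.Lmodule_isLalgebra.Build R T tscaleAl.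
HB.instance Definition _ := GRing.Lalgebra_isComAlgebra.Build R T.

Definition ti (k : 'I_n.+1) : T := tbasis (expo1 k).

Lemma tbasisM p q : tbasis p * tbasis q = tsign p q *: tbasis (addx p q).
Proof.
apply/ffunP => r; rewrite !ffunE (bigD1 p) //= [X in _ + X]big1 ?addr0.
  rewrite big_mkcond (bigD1 q) //= [X in _ + X]big1 ?addr0.
    rewrite !ffunE !eqxx !mulr1 [r == _]eq_sym.
    by case: eqP; rewrite /GRing.scale /= ?mulr1 ?mulr0.
  by move=> s /negbTE sq; rewrite !ffunE sq mulr0 if_same.
move=> s /negbTE sp; rewrite big1 // => u _.
by rewrite !ffunE sp mulr0 mul0r.
Qed.

Lemma ti_sqr k : ti k ^+ 2 = -1.
Proof.
rewrite expr2 tbasisM (_ : addx _ _ = expo0); last first.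
  by apply/ffunP => j; rewrite !ffunE addbb.
rewrite /tsign (bigD1 k) //= big1 ?mulr1; last first.
  by move=> j /negbTE jk; rewrite !ffunE jk.
by rewrite !ffunE eqxx expr1 scaleN1r.
Qed.

Lemma tbasisE p : tbasis p = \prod_k ti k ^+ p k.
Proof.
pose tr m : I := [ffun k : 'I_n.+1 => (k < m)%N && p k].
have tr0 : tr 0%N = expo0 by apply/ffunP => k; rewrite !ffunE.
have trS m (lemn : (m < n.+1)%N) : tbasis (tr m.+1) =
    ti (Ordinal lemn) ^+ p (Ordinal lemn) * tbasis (tr m).
  set j := Ordinal lemn.
  case pj: (p j); last first.
    rewrite expr0 mul1r; congr tbasis; apply/ffunP => k; rewrite !ffunE.
    rewrite ltnS leq_eqVlt -[m]/(val j) val_eqE.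
    by case: (eqVneq k j) => [->|//]; rewrite pj !andbF.
  rewrite expr1 [RHS]tbasisM /tsign big1; last first.
    move=> k _; rewrite !ffunE; case: (eqVneq k j) => [->|//] /=.
    by rewrite ltnn.
  rewrite scale1r; congr tbasis; apply/ffunP => k; rewrite !ffunE.
  rewrite ltnS leq_eqVlt -[m]/(val j) val_eqE.
  by case: (eqVneq k j) => [->|//] /=; rewrite ltnn pj.
have tr_prod m : (m <= n.+1)%N ->
    tbasis (tr m) = \prod_(k < n.+1 | (k < m)%N) ti k ^+ p k.
  elim: m => [_|m IHm lemn].
    by rewrite tr0 big_pred0.
  rewrite (trS _ lemn) (bigD1 (Ordinal lemn)) //= (IHm (ltnW lemn)).
  congr (_ * _); apply: eq_bigl => k.
  by rewrite [in RHS]ltnS [in RHS]andbC ltn_neqAle -val_eqE.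
have -> : p = tr n.+1 by apply/ffunP => k; rewrite ffunE ltn_ord.
rewrite (tr_prod _ (leqnn _)); apply: eq_big => [k|k _]; first by rewrite ltn_ord.
by rewrite ffunE ltn_ord.
Qed.

Lemma tensC_basis x : x = \sum_p x p *: tbasis p.
Proof.
apply/ffunP => q; rewrite sum_ffunE (bigD1 q) //= [X in _ + X]big1 ?addr0.
  by rewrite !ffunE eqxx [_ *: _]mulr1.
by move=> p /negbTE pq; rewrite !ffunE eq_sym pq scaler0.
Qed.

Lemma tensC_dim : \dim {: T} = (2 ^ n.+1)%N.
Proof. by rewrite dimvf /dim /= card_ffun card_bool card_ord muln1. Qed.

(* The exponential series and the integral are taken coordinatewise. *)
Definition texp x : T :=
  [ffun p => limn (series (fun m => (m`!%:R^-1 *: x ^+ m) p))].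

Definition tintegral (F : R -> T) : T :=
  [ffun p => \int[lebesgue_measure]_t F t p].

Let texp_norm x m p : `|(x ^+ m) p| <= (\sum_q `|x q|) ^+ m.
Proof.
suff le_sum : \sum_p `|(x ^+ m) p| <= (\sum_q `|x q|) ^+ m.
  apply: le_trans le_sum; rewrite (bigD1 p) //= lerDl.
  by apply: sumr_ge0 => q _.
elim: m => [|m IHm].
  rewrite !expr0 (bigD1 expo0) //= big1 => [|q /negbTE q0].
    by rewrite ffunE eqxx normr1 addr0.
  by rewrite ffunE q0 normr0.
rewrite !exprS; apply: (@le_trans _ _
    (\sum_r \sum_p \sum_(q | addx p q == r) `|x p| * `|(x ^+ m) q|)).
  apply: ler_sum => r _; rewrite ffunE.
  apply: le_trans (ler_norm_sum _ _ _) _; apply: ler_sum => s _.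
  apply: le_trans (ler_norm_sum _ _ _) _; apply: ler_sum => q _.
  rewrite !normrM /tsign normr_prod big1 ?mul1r // => k _.
  by rewrite normrX normrN1 expr1n.
rewrite exchange_big /= mulr_suml; apply: ler_sum => s _.
under eq_bigr do rewrite big_mkcond /=.
rewrite exchange_big /=.
under eq_bigr do
  rewrite -big_mkcond /= (eq_bigl _ _ (fun _ => eq_sym _ _)) big_pred1_eq.
by rewrite -mulr_sumr ler_wpM2l.
Qed.

Lemma is_cvg_texp x p :
  cvgn (series (fun m => (m`!%:R^-1 *: x ^+ m) p)).
Proof.
apply: normed_cvg.
apply: (@series_le_cvg _ _ (exp_coeff (\sum_q `|x q|))).
- by move=> m; rewrite /= normr_ge0.
- by move=> m; rewrite /exp_coeff /= divr_ge0 ?exprn_ge0 ?sumr_ge0.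
- move=> m; rewrite /exp_coeff /= ffunE normrM ger0_norm ?invr_ge0 //.
  by rewrite mulrC ler_wpM2r ?invr_ge0.
- exact: is_cvg_series_exp_coeff.
Qed.

End TensorAlgebra.

Section HypercomplexFourier.
Context {R : realType}.
Local Notation mu := (@lebesgue_measure R).
Implicit Types f g : R -> R.

Definition homega n (w : 'rV[R]_n.+1) : tensC R n := \sum_k w 0 k *: ti k.

Definition hfourier n f (w : 'rV[R]_n.+1) : tensC R n :=
  tintegral (fun t => f t *: texp (- (t *: homega w))).

(* Where the integral diverges this takes the junk value of Rintegral; for f
   and g integrable, that happens on a null set only. *)
Definition convolution f g : R -> R := fun x => \int[mu]_t (f t * g (x - t)).

Definition times_differentiable k f :=
  forall j, (j < k)%N -> forall x, derivable (f^`(j))%classic x 1.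

End HypercomplexFourier.

(* Main.v *)
Require Import Defs.
From HB Require Import structures.
From mathcomp Require Import all_boot all_order all_algebra.
From mathcomp Require Import all_classical all_reals all_analysis.
From mathcomp Require Import measurable_realfun.
From mathcomp Require Import ring lra.

Set Implicit Arguments.
Unset Strict Implicit.
Unset Printing Implicit Defensive.

Import Order.TTheory GRing.Theory Num.Theory.
Import numFieldNormedType.Exports.

Local Open Scope classical_set_scope.
Local Open Scope ring_scope.

(** Write e(t) for exp(- omega t).  Its coordinates solve the linear system
e' = - omega e, and uniqueness for that system gives everything that is used
about e: the law e(s + t) = e(s) e(t) ([texpD]), and the bound 1 on each
coordinate, because multiplication by omega is skew-symmetric for the Euclidean
structure of the monomial basis, so that the sum of the squares of the
coordinates of e is constant ([texp_homega_le1]).  Hence the transform of an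
integrable function exists and is linear, a translation by a multiplies it by
e(- a), and Fubini's theorem turns convolutions into products
([hfourier_convolution]).

For derivatives, the difficulty is that the intermediate derivatives of f are
not known to be integrable and that the k-th one may be discontinuous. The
bridge is the difference operator D g (t) = g (t + h) - g t. A function that is
derivable everywhere is the integral of its derivative as soon as the latter is
integrable ([FTC_derivable]); hence D g is the convolution of g' with the
indicator of [- h, 0], whose transform a satisfies omega a = e(- h) - 1.
Applying this k times to the differences of the derivatives of f, going down
from the k-th one, shows that D^k f has transform a^k times that of the k-th
derivative, while translation gives it (e(- h) - 1)^k times that of f. Thus a^k
kills omega^k F f - F (f^(k)) for every h > 0, and a / h tends to 1 as h tends
to 0 ([hfourier_derive1n]).

The only hard point of the fundamental theorem is the inequality
f b - f a <= \int u for an integrable u >= 0 above f' ([derivable_le_integral]).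
The level sets of u are covered by slightly larger open sets, and the weighted
measures of the latter between a and x add up to a function of x that grows
locally at least as fast as f, up to a small slope; it therefore dominates the
increment of f globally.

For injectivity, taking omega = c i_0 shows that a difference h of two functions
with the same transform is orthogonal to all the functions cos (c (x - t)).
Integrating against exp(- c) in c makes h orthogonal to the translates and
dilates of 1 / (1 + s^2), then integrating over an interval in x to differences
of arctangents, which tend boundedly to a multiple of the indicator of that
interval.  So h has integral 0 over every interval, and Lebesgue's
differentiation theorem concludes ([annihilate_ae]). *)

(** * The exponential of the algebra along a line *)

Lemma is_derive_fsum (R : realType) (I : Type) (r : seq I) (P : pred I)
    (h : I -> R -> R) (dh : I -> R) (t : R) :
  (forall i, P i -> is_derive t 1 (h i) (dh i)) ->
  is_derive t 1 (fun s => \sum_(i <- r | P i) h i s) (\sum_(i <- r | P i) dh i).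
Proof.
move=> dhi.
have -> : (fun s => \sum_(i <- r | P i) h i s) = \sum_(i <- r | P i) h i.
  by apply/funext => s; rewrite fct_sumE.
elim/big_ind2 : _ => //; first exact: is_derive_cst.
by move=> *; exact: is_deriveD.
Qed.

Lemma cvg_fsum (R : realType) (U : Type) (F : set_system U) {FF : Filter F}
    (I : Type) (r : seq I) (P : pred I) (h : I -> U -> R) (l : I -> R) :
  (forall i, P i -> h i x @[x --> F] --> l i) ->
  (\sum_(i <- r | P i) h i x) @[x --> F] --> \sum_(i <- r | P i) l i.
Proof.
move=> hl.
have -> : (fun x => \sum_(i <- r | P i) h i x) = \sum_(i <- r | P i) h i.
  by apply/funext => s; rewrite fct_sumE.
by elim/big_ind2 : _ => //; [exact: cvg_cst|move=> *; exact: cvgD].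
Qed.

Lemma cvg_pseries_sum (R : realType) (I : Type) (r : seq I) (P : pred I)
    (d : I -> R) (c : I -> R ^nat) (t : R) :
  (forall i, P i -> cvgn (pseries (c i) t)) ->
  pseries (fun m => \sum_(i <- r | P i) d i * c i m) t @ \oo -->
    \sum_(i <- r | P i) d i * limn (pseries (c i) t).
Proof.
move=> cvgc.
rewrite (_ : pseries _ t = fun N => \sum_(i <- r | P i) d i * pseries (c i) t N).
  by apply: cvg_fsum => i Pi; apply: cvgMl_tmp; exact: cvgc.
apply/funext => N; rewrite /pseries /series /=.
under [RHS]eq_bigr do rewrite mulr_sumr.
rewrite [RHS]exchange_big /=; apply: eq_bigr => m _.
by rewrite mulr_suml; apply: eq_bigr => i _; rewrite mulrA.
Qed.

Lemma pseries_diffs_sum (R : realType) (I : Type) (r : seq I) (P : pred I)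
    (d : I -> R) (c : I -> R ^nat) :
  pseries_diffs (fun m => \sum_(i <- r | P i) d i * c i m) =
  fun m => \sum_(i <- r | P i) d i * pseries_diffs (c i) m.
Proof.
apply/funext => m; rewrite /pseries_diffs mulr_sumr.
by apply: eq_bigr => i _; rewrite mulrCA.
Qed.

Section Exponential.
Context {R : realType} {n : nat}.
Local Notation T := (tensC R n).
Implicit Types (x : T) (u v : R -> T) (p : {ffun 'I_n.+1 -> bool}).

Lemma tmulE (x y : T) r :
  (x * y) r = \sum_p \sum_(q | addx p q == r) tsign p q * x p * y q.
Proof. exact: ffunE. Qed.

(** A single sum over pairs, so that linearity of limits, derivatives and
integrals is used once instead of twice. *)
Lemma tmul_pairE (x y : T) r :
  (x * y) r = \sum_(k | addx k.1 k.2 == r) tsign k.1 k.2 * x k.1 * y k.2.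
Proof. by rewrite tmulE pair_big_dep. Qed.

Lemma toneE r : (1 : T) r = (r == expo0)%:R.
Proof. exact: ffunE. Qed.

Lemma taddE (x y : T) r : (x + y) r = x r + y r.
Proof. exact: ffunE. Qed.

Lemma toppE (x : T) r : (- x) r = - x r.
Proof. exact: ffunE. Qed.

Lemma tscaleE (a : R) (x : T) r : (a *: x) r = a * x r.
Proof. exact: ffunE. Qed.

Lemma tzeroE r : (0 : T) r = 0.
Proof. exact: ffunE. Qed.

Lemma tsumE (I : Type) (s : seq I) (P : pred I) (F : I -> T) r :
  (\sum_(i <- s | P i) F i) r = \sum_(i <- s | P i) F i r.
Proof. by elim/big_rec2 : _ => [|i x y _ <-]; rewrite ?tzeroE// taddE. Qed.

(** The algebra carries no norm here; analysis in it is done on coordinates. *)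
Definition is_tderive u (t : R) (d : T) := forall p, is_derive t 1 (fun s => u s p) (d p).

Lemma is_tderiveM u v t (du dv : T) : is_tderive u t du -> is_tderive v t dv ->
  is_tderive (fun s => u s * v s) t (du * v t + u t * dv).
Proof.
move=> Du Dv r.
have -> : (fun s => (u s * v s) r) = (fun s => \sum_(k | addx k.1 k.2 == r)
    tsign k.1 k.2 * u s k.1 * v s k.2).
  by apply/funext => s; rewrite tmul_pairE.
apply: is_derive_eq.
  apply: is_derive_fsum => k _.
  exact: (is_deriveM (is_deriveZ (tsign k.1 k.2) (Du k.1)) (Dv k.2)).
rewrite taddE !tmul_pairE -big_split; apply: eq_bigr => k _ /=.
by rewrite /GRing.scale /=; ring.
Qed.

(** Each coordinate is a power series in the scalar, and its termwise
derivative is a linear combination of the other coordinates, with the structure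
constants of multiplication by x as coefficients. *)
Lemma is_tderive_texp x t : is_tderive (fun s => texp (s *: x)) t (x * texp (t *: x)).
Proof.
move=> p; pose c q m : R := m`!%:R^-1 * (x ^+ m) q.
have texpE q : (fun s => texp (s *: x) q) = fun s => limn (pseries (c q) s).
  apply/funext => s; rewrite ffunE; congr (limn (series _)); apply/funext => m.
  by rewrite exprZn !tscaleE /c /=; ring.
have cvgc q s : cvgn (pseries (c q) s).
  have := @is_cvg_texp R n (s *: x) q.
  rewrite (_ : (fun m => _) = fun m => c q m * s ^+ m)//.
  by apply/funext => m; rewrite exprZn !tscaleE /c /=; ring.
(* The matrix of multiplication by x in the monomial basis. *)
pose d (k : {ffun 'I_n.+1 -> bool} * {ffun 'I_n.+1 -> bool}) : R :=
  tsign k.1 k.2 * x k.1.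
have diffc q : pseries_diffs (c q) =
    fun m => \sum_(k | addx k.1 k.2 == q) d k * c k.2 m.
  apply/funext => m; rewrite /pseries_diffs /c factS natrM exprS tmul_pairE invfM.
  rewrite !mulrA mulfV ?pnatr_eq0// mul1r mulr_sumr.
  by apply: eq_bigr => k _; rewrite /d; ring.
have cvgdc q s : cvgn (pseries (pseries_diffs (c q)) s).
  by rewrite diffc; apply/cvg_ex; eexists; exact: cvg_pseries_sum.
have cvgddc q s : cvgn (pseries (pseries_diffs (pseries_diffs (c q))) s).
  rewrite diffc pseries_diffs_sum.
  by apply/cvg_ex; eexists; exact: cvg_pseries_sum.
rewrite texpE; apply: is_derive_eq.
  apply: (@pseries_snd_diffs R (c p) (`|t| + 1) t) => //.
  by rewrite [ltRHS]ger0_norm ?addr_ge0// ltrDl ltr01.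
rewrite diffc tmul_pairE; apply/cvg_lim => //.
rewrite (eq_bigr (fun k => d k * limn (pseries (c k.2) t))); last first.
  by move=> k _; rewrite -[X in _ = _ * X](congr1 (@^~ t) (texpE k.2)).
exact: cvg_pseries_sum.
Qed.

Lemma texp0 : texp (0 : T) = 1.
Proof.
apply/ffunP => p; rewrite ffunE; apply/cvg_lim => //.
rewrite -(cvg_shiftn 1%N).
apply: cvg_near_cst; apply: nearW => N.
rewrite /series /= addn1 big_mkord big_ord_recl /= big1 ?addr0.
  by rewrite fact0 invr1 scale1r.
by move=> i _; rewrite /bump leq0n expr0n scaler0 tzeroE.
Qed.

Lemma is_tderive_cst u : (forall t, is_tderive u t 0) -> forall t, u t = u 0.
Proof.
move=> u0 t; apply/ffunP => p; apply: (@is_derive_0_is_cst _ (fun s => u s p)) => s.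
by have := u0 s p; rewrite tzeroE.
Qed.

Lemma texpNM x t : texp (t *: - x) * texp (t *: x) = 1.
Proof.
have -> := @is_tderive_cst (fun t => texp (t *: - x) * texp (t *: x)).
  by rewrite !scale0r texp0 mulr1.
move=> s; rewrite (_ : 0 = - x * texp (s *: - x) * texp (s *: x) +
    texp (s *: - x) * (x * texp (s *: x))); last first.
  by rewrite mulrCA mulrA !mulNr addNr.
by apply: is_tderiveM; exact: is_tderive_texp.
Qed.

(** Multiplying by exp(- t x) makes the derivative vanish. *)
Lemma texp_unique x v : (forall t, is_tderive v t (x * v t)) ->
  forall t, v t = texp (t *: x) * v 0.
Proof.
move=> dv t.
have wE : texp (t *: - x) * v t = v 0.
  rewrite (@is_tderive_cst (fun t => texp (t *: - x) * v t)) => [|s].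
    by rewrite !scale0r texp0 mul1r.
  rewrite (_ : 0 = - x * texp (s *: - x) * v s + texp (s *: - x) * (x * v s)).
    by apply: is_tderiveM; [exact: is_tderive_texp|].
  by rewrite mulrCA mulrA !mulNr addNr.
by rewrite -wE mulrA [texp (t *: x) * _]mulrC texpNM mul1r.
Qed.

(** As functions of t, both sides solve the same linear system. *)
Lemma texpD x s t : texp ((s + t) *: x) = texp (s *: x) * texp (t *: x).
Proof.
rewrite [RHS]mulrC.
have := @texp_unique x (fun t => texp ((s + t) *: x)).
rewrite addr0; apply => r p.
have -> : (fun t => texp ((s + t) *: x) p) = (fun t => texp (t *: x) p) \o shift s.
  by apply/funext => u /=; rewrite addrC.
apply: is_derive_eq.
  have Ds : is_derive r 1 (shift s) (1 : R) by exact: is_derive_shift.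
  exact: (is_derive1_comp (is_tderive_texp x (shift s r) p) Ds).
by rewrite /= mulr1 addrC.
Qed.

Lemma texp_continuous x p : continuous (fun t : R => texp (t *: x) p).
Proof.
move=> t; apply/differentiable_continuous/derivable1_diffP.
exact: (@ex_derive _ _ _ _ _ _ _ (is_tderive_texp x t p)).
Qed.

(** Multiplication by a generator permutes the basis up to sign, toggling one
exponent; the sign is -1 exactly when the exponent was 1. *)
Lemma tiM k x r : (ti k * x) r = (-1) ^+ (~~ r k) * x (addx (expo1 k) r).
Proof.
rewrite tmulE (bigD1 (expo1 k)) //= [X in _ + X]big1 ?addr0; last first.
  by move=> p /negbTE pk; rewrite big1// => q _; rewrite ffunE pk mulr0 mul0r.
rewrite (big_pred1 (addx (expo1 k) r)) => [|q /=]; last first.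
  apply/eqP/eqP => [<-|->]; apply/ffunP => j; rewrite !ffunE.
    by rewrite addbA addbb addFb.
  by rewrite addbA addbb addFb.
rewrite ffunE eqxx mulr1; congr (_ * _).
rewrite /tsign (bigD1 k) //= big1 ?mulr1 => [|j /negbTE jk].
  by rewrite !ffunE eqxx.
by rewrite !ffunE jk.
Qed.

(** Each generator acts skew-symmetrically: toggling the exponent k pairs the
terms of the sum, with opposite signs. *)
Lemma homega_skew (w : 'rV[R]_n.+1) x : \sum_p x p * (homega w * x) p = 0.
Proof.
have -> : \sum_p x p * (homega w * x) p =
    \sum_k w 0 k * \sum_p x p * (ti k * x) p.
  transitivity (\sum_p \sum_k w 0 k * (x p * (ti k * x) p)).
    apply: eq_bigr => p _; rewrite /homega mulr_suml tsumE mulr_sumr.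
    by apply: eq_bigr => k _; rewrite -scalerAl tscaleE mulrCA.
  by rewrite exchange_big; apply: eq_bigr => k _; rewrite mulr_sumr.
apply: big1 => k _; set S := (X in _ * X).
suff : S = - S by move=> ?; rewrite (_ : S = 0) ?mulr0//; lra.
have addxK : involutive (addx (expo1 k)).
  by move=> p; apply/ffunP => j; rewrite !ffunE addbA addbb addFb.
rewrite {1}/S (reindex_inj (inv_inj addxK)) /= -sumrN; apply: eq_bigr => p _.
rewrite !tiM addxK !ffunE eqxx addTb.
by case: (p k); rewrite /=; ring.
Qed.

(** By skew-symmetry, the squares of the coordinates add up to a constant,
which is 1 at t = 0. *)
Lemma texp_homega_le1 (w : 'rV[R]_n.+1) t p : `|texp (t *: homega w) p| <= 1.
Proof.
pose e t := texp (t *: homega w).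
have sqE : \sum_q (e t q) ^+ 2 = 1.
  transitivity (\sum_q (e 0 q) ^+ 2); last first.
    rewrite /e scale0r texp0 (bigD1 expo0) //= big1 => [|q /negbTE q0].
      by rewrite toneE eqxx expr1n addr0.
    by rewrite toneE q0 expr0n.
  apply: (@is_derive_0_is_cst _ (fun t => \sum_q (e t q) ^+ 2)) => s.
  apply: is_derive_eq.
    apply: is_derive_fsum => q _.
    exact: (@is_deriveX _ _ _ 2 _ _ _ (is_tderive_texp (homega w) s q)).
  transitivity (2 * \sum_q e s q * (homega w * e s) q).
    by rewrite mulr_sumr; apply: eq_bigr => q _; rewrite expr1 mulrA.
  by rewrite homega_skew mulr0.
rewrite -(@ler_pXn2r _ 2)// ?nnegrE// expr1n -normrX ger0_norm ?sqr_ge0//.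
rewrite -sqE (bigD1 p) //= lerDl; apply: sumr_ge0 => q _; exact: sqr_ge0.
Qed.

(** Both sides solve the same linear system, since the square of a generator
is -1. *)
Lemma texp_ti a k t :
  texp (t *: (a *: ti k)) = cos (a * t) *: (1 : T) + sin (a * t) *: ti k.
Proof.
pose v s : T := cos (a * s) *: (1 : T) + sin (a * s) *: ti k.
suff Dv s : is_tderive v s (a *: ti k * v s).
  have := texp_unique Dv t.
  by rewrite {2}/v mulr0 cos0 sin0 scale0r addr0 scale1r mulr1 => <-.
move=> p.
rewrite (_ : (fun t => v t p) =
    (fun t => (1 : T) p * cos (a * t) + ti k p * sin (a * t))); last first.
  by apply/funext => r; rewrite taddE !tscaleE mulrC [X in _ + X]mulrC.
have Da : is_derive s 1 (fun s => a * s) a.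
  by have := is_deriveZ a (is_derive_id s (1 : R)); rewrite [a *: _]mulr1.
have Dc := is_derive1_comp (is_derive_cos (a * s)) Da.
have Ds := is_derive1_comp (is_derive_sin (a * s)) Da.
have := is_deriveD (is_deriveZ ((1 : T) p) Dc) (is_deriveZ (ti k p) Ds).
move=> /is_derive_eq; apply.
have -> : a *: ti k * v s = (a * cos (a * s)) *: ti k - (a * sin (a * s)) *: (1 : T).
  rewrite mulrDr -!scalerAl -!scalerAr mulr1 -expr2 ti_sqr !scalerN !scalerA.
  by [].
by rewrite taddE toppE !tscaleE /GRing.scale /=; ring.
Qed.

End Exponential.

(** * Integrable functions, Fubini and translations *)

Section Integrability.
Context d (X : measurableType d) {R : realType} (mu : {measure set X -> \bar R}).
Implicit Types (D : set X) (f k : X -> R).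

Lemma integrableM_bnd D f k C : measurable D ->
  mu.-integrable D (EFin \o f) -> measurable_fun D k ->
  (forall x, D x -> `|k x| <= C) ->
  mu.-integrable D (EFin \o (fun x => f x * k x)).
Proof.
move=> mD fi mk kC.
apply: (integrableMl mD fi mk); exists C; split; first exact: num_real.
by move=> M CM x Dx; apply: le_trans (kC x Dx) (ltW CM).
Qed.

Lemma integrable_EFinD D f k : measurable D ->
  mu.-integrable D (EFin \o f) -> mu.-integrable D (EFin \o k) ->
  mu.-integrable D (EFin \o (fun x => f x + k x)).
Proof. by move=> mD fi ki; exact: (integrableD mD fi ki). Qed.

Lemma integrable_EFinZ D (c : R) f : measurable D ->
  mu.-integrable D (EFin \o f) -> mu.-integrable D (EFin \o (fun x => c * f x)).
Proof. by move=> mD fi; have := integrableZl mD c fi. Qed.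

Lemma integrable_EFin_sum D (I : Type) (r : seq I) (P : pred I) (F : I -> X -> R) :
  measurable D -> (forall i, P i -> mu.-integrable D (EFin \o F i)) ->
  mu.-integrable D (EFin \o (fun x => \sum_(i <- r | P i) F i x)).
Proof.
move=> mD Fi; have := integrable_sum mD r Fi.
by congr (_.-integrable _ _); apply/funext => x /=; rewrite sumEFin.
Qed.

Lemma Rintegral_sum D (I : Type) (r : seq I) (P : pred I) (F : I -> X -> R) :
  measurable D -> (forall i, P i -> mu.-integrable D (EFin \o F i)) ->
  \int[mu]_(x in D) (\sum_(i <- r | P i) F i x) =
  \sum_(i <- r | P i) \int[mu]_(x in D) F i x.
Proof.
move=> mD Fi; elim: r => [|i r IHr].
  under eq_Rintegral do rewrite big_nil.
  by rewrite big_nil Rintegral_cst// mul0r.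
rewrite big_cons -IHr; under eq_Rintegral do rewrite big_cons.
case: ifPn => // Pi; rewrite RintegralD//; first exact: Fi.
exact: integrable_EFin_sum.
Qed.

Lemma ae_eq_Rintegral D f k : measurable D ->
  measurable_fun D f -> measurable_fun D k ->
  (\forall x \ae mu, D x -> f x = k x) ->
  \int[mu]_(x in D) f x = \int[mu]_(x in D) k x.
Proof.
move=> mD mf mk fk; congr fine; apply: ae_eq_integral => //.
- exact/measurable_EFinP.
- exact/measurable_EFinP.
by apply: filterS fk => x + Dx => /= ->.
Qed.

Lemma dominated_Rintegral D (f_ : nat -> X -> R) f g : measurable D ->
  (forall m, measurable_fun D (f_ m)) ->
  (forall x, D x -> f_ ^~ x @ \oo --> f x) ->
  mu.-integrable D (EFin \o g) ->
  (forall m x, D x -> `|f_ m x| <= g x) ->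
  (fun m => \int[mu]_(x in D) f_ m x) @ \oo --> \int[mu]_(x in D) f x.
Proof.
move=> mD mf_ f_f gi f_g.
have mf : measurable_fun D f by exact: (measurable_fun_cvg mf_ f_f).
have [] // := @dominated_convergence _ _ _ mu _ mD
    (fun m x => (f_ m x)%:E) (EFin \o f) (EFin \o g).
- by move=> m; exact/measurable_EFinP.
- exact/measurable_EFinP.
- by apply: aeW => x Dx; apply: cvg_EFin; [exact: nearW|exact: f_f].
- by apply: aeW => x m Dx; rewrite lee_fin; exact: f_g.
move=> fi _ cvgi.
apply: fine_cvg; rewrite fineK//; exact: integrable_fin_num.
Qed.

End Integrability.

(** This passes from integrals of extended reals to those of reals: an
integrable function is finite almost everywhere. *)
Lemma integrable_fine d (X : measurableType d) {R : realType}
    (mu : {measure set X -> \bar R}) (f : X -> \bar R) :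
  mu.-integrable setT f ->
  mu.-integrable setT (EFin \o (fine \o f)) /\
  \int[mu]_x (fine (f x)) = fine (\int[mu]_x f x)%E.
Proof.
move=> fi; have mf := measurable_int _ fi.
have mff : measurable_fun setT (EFin \o (fine \o f)).
  by apply/measurable_EFinP; apply: measurableT_comp mf; exact: fine_measurable.
have fE : ae_eq mu setT (EFin \o (fine \o f)) f.
  have := integrable_ae measurableT fi.
  by apply: filterS => x /(_ I) fx _; rewrite /= fineK.
split; last by congr fine; exact: ae_eq_integral.
apply/integrableP; split => //; move/integrableP : fi => [_].
congr (_ < _)%E; apply: ae_eq_integral => //; [exact: measurableT_comp..|].
by apply: filterS fE => x /(_ I) fx _; rewrite -fx.
Qed.

Section Fubini.
Context d1 d2 (X : measurableType d1) (Y : measurableType d2) {R : realType}.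
Variables (m1 : {sigma_finite_measure set X -> \bar R})
  (m2 : {sigma_finite_measure set Y -> \bar R}).
Variable F : X * Y -> R.
Hypothesis Fi : (m1 \x m2)%E.-integrable setT (EFin \o F).

Let integrable_G : m2.-integrable setT (fubini_G m1 (EFin \o F)).
Proof.
have mF := measurable_int _ Fi; have mG := measurable_fubini_G Fi.
apply/integrableP; split => //.
apply: le_lt_trans ((integrable21ltyP _ _ mF).1 Fi).
apply: ge0_le_integral => //; first exact: measurableT_comp.
- apply: (measurable_fun_fubini_tonelli_G (abse \o (EFin \o F))) => //.
    exact: measurableT_comp.
  by move=> z /=.
- move=> y _; apply: le_abse_integral => //.
  exact: (measurableT_comp mF (measurable_pair2 y)).
Qed.

Lemma integrable_Rfubini2 :
  m2.-integrable setT (EFin \o (fun y => \int[m1]_x F (x, y))).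
Proof. by have [] := integrable_fine integrable_G. Qed.

Lemma Rfubini :
  \int[m1]_x \int[m2]_y F (x, y) = \int[m2]_y \int[m1]_x F (x, y).
Proof.
have [_ E1] := integrable_fine (integrable_fubini_F Fi).
have [_ E2] := integrable_fine integrable_G.
by rewrite [LHS]E1 [RHS]E2 (Fubini Fi).
Qed.

End Fubini.

Section LebesguePlane.
Context {R : realType}.
Local Notation mu := (@lebesgue_measure R).
Implicit Types (f g : R -> R).

Lemma lebesgue_measure_shift (a : R) (A : set R) : measurable A ->
  mu (shift a @^-1` A) = mu A.
Proof.
have mshift : measurable_fun setT (shift a : measurableTypeR R -> measurableTypeR R).
  by apply: measurable_funD.
pose phi : {mfun measurableTypeR R >-> measurableTypeR R} :=
  HB.pack (shift a : measurableTypeR R -> measurableTypeR R)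
    (isMeasurableFun.Build _ _ _ _ _ mshift).
move=> mA; apply/esym.
apply: (@lebesgue_measure_unique R (pushforward mu phi)) => // _ [[x y] _ <-].
transitivity (mu `]x - a, y - a]); last first.
  by congr (mu _); apply/seteqP; split => z /=; rewrite !in_itv/= ltrBlDr lerBrDr.
rewrite [LHS]lebesgue_measure_itv [RHS]lebesgue_measure_itv/= !lte_fin ltrD2r.
by case: ifPn => // _; rewrite -!EFinB; congr EFin; ring.
Qed.

Lemma ge0_integral_shift (a : R) (f : R -> \bar R) :
  measurable_fun setT f -> (forall x, 0 <= f x)%E ->
  (\int[mu]_x f (x + a)%R = \int[mu]_x f x)%E.
Proof.
move=> mf f0.
have mshift : measurable_fun setT (shift a : measurableTypeR R -> measurableTypeR R).
  by apply: measurable_funD.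
have := ge0_integral_pushforward mshift mu measurableT mf (fun x _ => f0 x).
rewrite preimage_setT => <-.
by apply: eq_measure_integral => A mA _; exact: lebesgue_measure_shift.
Qed.

Lemma integrable_shift (a : R) f : mu.-integrable setT (EFin \o f) ->
  mu.-integrable setT (EFin \o (fun x => f (x + a))).
Proof.
move=> /integrableP[mf fi]; apply/integrableP; split.
  apply: measurableT_comp mf _; exact: measurable_funD.
rewrite (@ge0_integral_shift a (fun x => `|(f x)%:E|%E))//.
exact: measurableT_comp.
Qed.

Lemma Rintegral_shift (a : R) f : mu.-integrable setT (EFin \o f) ->
  \int[mu]_x f (x + a) = \int[mu]_x f x.
Proof.
move=> /integrableP[mf fi]; congr fine.
rewrite [LHS]integralE [RHS]integralE; congr (_ - _)%E.
- rewrite -[RHS](@ge0_integral_shift a ((EFin \o f)^\+)%E)//.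
  + by apply: eq_integral => x _; rewrite !funeposE.
  + exact: measurable_funepos.
- rewrite -[RHS](@ge0_integral_shift a ((EFin \o f)^\-)%E)//.
  + by apply: eq_integral => x _; rewrite !funenegE.
  + exact: measurable_funeneg.
Qed.

Lemma continuous_itv_integrable f a b : continuous f ->
  mu.-integrable `[a, b] (EFin \o f).
Proof.
move=> cf; apply: continuous_compact_integrable; first exact: segment_compact.
exact: continuous_subspaceT.
Qed.

(** With s = 0 this serves products of functions of separate variables, with
s = - id convolutions: the shear is invisible to the integral in the second
variable, by translation invariance. *)
Lemma integrable_skew f g (s : R -> R) (k : R * R -> R) C :
  mu.-integrable setT (EFin \o f) -> mu.-integrable setT (EFin \o g) ->
  measurable_fun setT s ->
  measurable_fun setT k -> (forall z, `|k z| <= C) ->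
  (mu \x mu)%E.-integrable setT
    (EFin \o (fun z => f z.1 * g (z.2 + s z.1) * k z)).
Proof.
move=> fi gi ms mk kC.
have /measurable_EFinP mf := measurable_int _ fi.
have /measurable_EFinP mg := measurable_int _ gi.
have msz : measurable_fun setT (fun z : R * R => z.2 + s z.1).
  apply: measurable_funD; first exact: measurable_snd.
  exact: (measurableT_comp ms measurable_fst).
have mfg : measurable_fun setT (fun z : R * R => f z.1 * g (z.2 + s z.1)).
  apply: measurable_funM.
    exact: (measurableT_comp mf measurable_fst).
  exact: (measurableT_comp mg msz).
have := @integrableM_bnd _ _ _ (mu \x mu)%E setT
  (fun z => f z.1 * g (z.2 + s z.1)) k C.
apply=> //.
apply/integrable12ltyP; first exact/measurable_EFinP.
pose K := (\int[mu]_y `|(g y)%:E|)%E.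
have Kfin : K \is a fin_num.
  by rewrite ge0_fin_numE ?integral_ge0//; case/integrableP : gi.
have K0 : (0 <= K)%E by exact: integral_ge0.
apply: (@le_lt_trans _ _ (\int[mu]_x ((fine K)%:E * `|(f x)%:E|))%E).
  rewrite le_eqVlt; apply/orP; left; apply/eqP; apply: eq_integral => x _.
  rewrite fineK// muleC /K -(@ge0_integral_shift (s x) (fun y => `|(g y)%:E|%E))//.
    rewrite -ge0_integralZl//.
      by apply: eq_integral => y _ /=; rewrite normrM EFinM.
    do 2 apply: measurableT_comp => //.
    by apply: (measurableT_comp mg); exact: measurable_funD.
  by do 2 apply: measurableT_comp => //.
rewrite ge0_integralZl//; [|by do 2 apply: measurableT_comp => //|by rewrite lee_fin fine_ge0].
by rewrite fineK// lte_mul_pinfty//; case/integrableP : fi.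
Qed.

End LebesguePlane.

(** * The fundamental theorem of calculus for everywhere derivable functions *)

Section EverywhereDerivable.
Context {R : realType}.
Local Notation mu := (@lebesgue_measure R).
Implicit Types (f u : R -> R) (a b : R).

(** The supremum of the points up to which the increment of f is dominated is
such a point, since f is continuous and G nondecreasing (G itself may jump), and
it could be pushed further to the right if it were not b. *)
Lemma increment_le_local f G a b : a <= b -> {in `[a, b], continuous f} ->
  {in `[a, b] &, {homo G : x y / x <= y}} ->
  (forall s, a <= s < b -> exists2 y, s < y <= b & f y - f s <= G y - G s) ->
  f b - f a <= G b - G a.
Proof.
move=> ab cf ndG step.
pose S := [set x | a <= x <= b /\ f x - f a <= G x - G a].
have Sa : S a by rewrite /S /= lexx ab !subrr.
have supS : has_sup S by split; [exists a|exists b => x [/andP[]]].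
pose s := sup S.
have sa : a <= s by exact: (ub_le_sup supS.2 Sa).
have sb : s <= b by apply: ge_sup => //; [exists a|move=> x [/andP[]]].
have sab : s \in `[a, b] by rewrite in_itv /= sa sb.
have Ss : f s - f a <= G s - G a.
  rewrite leNgt; apply/negP => lts.
  have e0 : 0 < (f s - f a) - (G s - G a) by rewrite subr_gt0.
  have /cvgrPdist_lt /(_ _ e0) := cf s sab.
  move=> [d /= d0 fd].
  have [x [/andP[ax xb] Sx] sx] := sup_adherent d0 supS.
  have xs : x <= s by apply: (ub_le_sup supS.2); split => //; rewrite ax xb.
  have xab : x \in `[a, b] by rewrite in_itv /= ax xb.
  have /= := fd x; rewrite ger0_norm ?subr_ge0// ltrBlDr -ltrBlDl => /(_ sx).
  have Gxs := ndG x s xab sab xs.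
  move/ltr_normlW; lra.
have [sb'|] := ltP s b; last first.
  by move=> bs; have -> : b = s by apply/eqP; rewrite eq_le bs sb.
have [y /andP[sy yb] fy] := step s (introT andP (conj sa sb')).
have Sy : S y by split; [rewrite yb (le_trans sa (ltW sy))|lra].
by have := ub_le_sup supS.2 Sy; rewrite leNgt sy.
Qed.

(** At a point x, the levels k with k * eta < u x number at most
u x / eta + 1, so the weighted measures of the level sets add up to at most the
integral of u + eta; outer regularity enlarges the k-th one to an open set at the
cost of 1 / 2^(k+1). *)
Lemma open_layer_cover u (D : set R) (eta : R) : measurable D ->
  (mu D < +oo)%E -> 0 < eta -> (forall x, D x -> 0 <= u x) ->
  mu.-integrable D (EFin \o u) ->
  exists U : nat -> set R,
    [/\ forall k, open (U k),
        forall k x, D x -> k%:R * eta < u x -> U k x &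
        (\sum_(k <oo) eta%:E * mu (U k `&` D) <=
           \int[mu]_(x in D) (u x)%:E + eta%:E * mu D + eta%:E)%E].
Proof.
move=> mD Dfin eta0 u0 ui.
have /measurable_EFinP mu_ := measurable_int _ ui.
pose A k := D `&` [set x | k%:R * eta < u x].
have mA k : measurable (A k).
  rewrite (_ : A k = D `&` u @^-1` `]k%:R * eta, +oo[).
    by apply: mu_ => //; exact: measurable_itv.
  by apply/seteqP; split => x [Dx] /=; rewrite in_itv /= andbT.
have Afin k : (mu (A k) < +oo)%E.
  apply: (le_lt_trans _ Dfin); apply: le_measure; rewrite ?inE//.
    exact: mA.
  exact: subIsetl.
have e0 k : 0 < (2 ^ k.+1)%:R^-1 :> R by rewrite invr_gt0 ltr0n expn_gt0.
have /choice [U HU] : forall k, exists U : set R, [/\ open U, A k `<=` U &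
    (mu (U `\` A k) < (2 ^ k.+1)%:R^-1%:E)%E].
  move=> k; exact: (lebesgue_regularity_outer (mA k) (Afin k) (e0 k)).
exists U; split.
- by move=> k; have [] := HU k.
- by move=> k x Dx kx; have [_ + _] := HU k; apply.
have mU k : measurable (U k) by apply: open_measurable; have [] := HU k.
have UA k : (eta%:E * mu (U k `&` D) <= eta%:E * mu (A k) + (eta / (2 ^ k.+1)%:R)%:E)%E.
  have [oU AU] := HU k; move=> Ulek.
  rewrite EFinM -muleDr ?fin_num_adde_defl ?fin_numE//.
  rewrite lee_pmul2l ?lte_fin//.
  apply: (@le_trans _ _ (mu (A k `|` (U k `\` A k)))).
    apply: le_measure; rewrite ?inE//.
    - by apply: measurableI; [exact: mU|exact: mD].
    - by apply: measurableU; [exact: mA|apply: measurableD; [exact: mU|exact: mA]].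
    - by move=> x [Ux _]; have [Ax|nAx] := pselect (A k x); [left|right].
  have mUA : measurable (U k `\` A k) by apply: measurableD; [exact: mU|exact: mA].
  apply: (@le_trans _ _ (mu (A k) + mu (U k `\` A k))%E).
    by apply: measureU2; [exact: mA|exact: mUA].
  by apply: leeD => //; exact: ltW.
apply: (@le_trans _ _ (\sum_(k <oo) (eta%:E * mu (A k) + (eta / (2 ^ k.+1)%:R)%:E))%E).
  apply: lee_nneseries => [k _ _|k _]; last exact: UA.
  by rewrite mule_ge0// lee_fin ltW.
apply: le_trans (epsilon_trick _ _ (ltW eta0)) _.
  by move=> k; rewrite mule_ge0// lee_fin ltW.
apply: leeD => //.
have -> : (\int[mu]_(x in D) (u x)%:E + eta%:E * mu D = \int[mu]_(x in D) (u x + eta)%:E)%E.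
  have -> : (eta%:E * mu D = \int[mu]_(x in D) eta%:E)%E.
    exact/esym/integral_cst.
  rewrite -ge0_integralD//; first exact/measurable_EFinP.
  by move=> x _; rewrite lee_fin ltW.
rewrite (eq_eseriesr (g := fun k => \int[mu]_(x in D) (eta * \1_(A k) x)%:E)%E); last first.
  move=> k _.
  rewrite (@eq_integral _ _ _ mu D (fun x => (eta%:E * (\1_(A k) x)%:E)%E)); last by [].
  rewrite ge0_integralZl//; last 2 first.
  - by apply/measurable_EFinP/measurable_indic; exact: mA.
  - by rewrite lee_fin ltW.
  rewrite integral_indic//; last exact: mA.
  by congr (_ * mu _)%E; rewrite /A setIAC setIid.
rewrite -integral_nneseries//; last 2 first.
- move=> k; apply/measurable_EFinP/measurable_funM => //.
  by apply: measurable_indic; exact: mA.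
- by move=> k x Dx; rewrite lee_fin mulr_ge0// ltW.
apply: ge0_le_integral => //.
- by move=> x Dx; apply: nneseries_ge0 => k _ _; rewrite lee_fin mulr_ge0// ltW.
- apply: ge0_emeasurable_sum => //.
  + by move=> k x Dx _; rewrite lee_fin mulr_ge0// ltW.
  + move=> k _; apply/measurable_EFinP/measurable_funM => //.
    by apply: measurable_indic; exact: mA.
- by apply/measurable_EFinP; exact: measurable_funD.
move=> x Dx; apply: lime_le.
  by apply: is_cvg_nneseries => k _ _; rewrite lee_fin mulr_ge0// ltW.
apply: nearW => N; rewrite sumEFin lee_fin -mulr_sumr.
elim: N => [|N IHN]; first by rewrite big_nil mulr0 addr_ge0// ?u0// ltW.
rewrite big_nat_recr//= indicE; have [/set_mem[_ /= Nu]|_] := boolP (x \in A N); last first.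
  by rewrite addr0.
suff : \sum_(0 <= k < N) \1_(A k) x <= N%:R :> R.
  rewrite -(ler_pM2l eta0) mulrDr mulr1 [eta * N%:R]mulrC; lra.
rewrite -[N in N%:R]subn0 -[leRHS]mulr1 mulr_natl -sumr_const_nat.
by apply: ler_sum => k _; rewrite indicE; case: (_ \in _).
Qed.

Lemma minimal_multiple (eta c : R) : 0 < eta -> 0 <= c ->
  exists2 K : nat, c <= K%:R * eta & forall k, (k < K)%N -> k%:R * eta < c.
Proof.
move=> eta0 c0.
have exK : exists K : nat, c <= K%:R * eta.
  exists (Num.truncn (c / eta)).+1; rewrite -ler_pdivrMr//.
  by apply/ltW; exact: truncnS_gt.
case: (ex_minnP exK) => K cK minK; exists K => // k kK.
by rewrite ltNge; apply/negP => /minK; rewrite leqNgt kK.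
Qed.

Lemma derivable_right_step f (s c d : R) : derivable f s 1 -> 'D_1 f s < c ->
  0 < d -> exists2 h : R, 0 < h < d & f (s + h) - f s <= c * h.
Proof.
move=> df fc d0.
have e0 : 0 < c - 'D_1 f s by rewrite subr_gt0.
have dfs : h^-1 *: (f (h *: 1 + s) - f s) @[h --> 0^'] --> 'D_1 f s.
  exact: df.
have /cvgrPdist_lt /(_ _ e0) := dfs.
move=> [r /= r0 fr].
pose h := Num.min (r / 2) (d / 2).
have h0 : 0 < h by rewrite lt_min !divr_gt0.
have hd : h < d.
  by apply: (@le_lt_trans _ _ (d / 2)); [rewrite ge_min lexx orbT|lra].
have hr : h < r.
  by apply: (@le_lt_trans _ _ (r / 2)); [rewrite ge_min lexx|lra].
exists h; first by rewrite h0 hd.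
have := fr h; rewrite /= sub0r normrN gtr0_norm// gt_eqF// => /(_ hr isT).
rewrite distrC [h *: 1]mulr1 [h + s]addrC => /ltr_normlW.
rewrite ltrBlDr subrK /GRing.scale /= mulrC ltr_pdivrMr// => /ltW.
by [].
Qed.

(** With U k the open covers of the levels of u, the comparison function adds
eta * x to the sum over k of eta times the measure of U k between a and x.  At a
point s, let K be least such that u s <= K * eta: the first K covers contain a
neighbourhood of s, so the slope of the comparison function to the right of s is
at least (K + 1) * eta > f' s. *)
Lemma derivable_le_integral f u a b : a <= b ->
  (forall x, derivable f x 1) ->
  (forall x, a <= x <= b -> 'D_1 f x <= u x) ->
  (forall x, a <= x <= b -> 0 <= u x) ->
  mu.-integrable `[a, b] (EFin \o u) ->
  f b - f a <= \int[mu]_(x in `[a, b]) u x.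
Proof.
move=> ab df fu u0 ui.
suff main (eta : R) : 0 < eta ->
    f b - f a <= \int[mu]_(x in `[a, b]) u x + eta * (2 * (b - a) + 1).
  apply/ler_addgt0Pr => e e0.
  have c0 : 0 < 2 * (b - a) + 1 by lra.
  by have := main (e / (2 * (b - a) + 1)); rewrite divfK ?gt_eqF// divr_gt0// => /(_ isT).
move=> eta0.
have muab x y : x <= y -> mu `[x, y] = (y - x)%:E.
  move=> xy; rewrite lebesgue_measure_itv /= lte_fin; case: ltgtP xy => // -> _.
  by rewrite subrr.
have Dab x : `[a, b]%classic x = (a <= x <= b) by rewrite /= in_itv.
have [] := @open_layer_cover u `[a, b] eta (measurable_itv _) _ eta0 _ ui.
- by rewrite [mu _](muab a b ab) ltry.
- by move=> x; rewrite Dab; exact: u0.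
move=> U [oU uU HU].
have mU k : measurable (U k) by apply: open_measurable; exact: oU.
have mUx k x : measurable (U k `&` `[a, x]).
  by apply: measurableI; [exact: mU|exact: measurable_itv].
pose H x := (\sum_(k <oo) eta%:E * mu (U k `&` `[a, x]))%E.
have term0 k x : (0 <= eta%:E * mu (U k `&` `[a, x]))%E.
  by rewrite mule_ge0// lee_fin ltW.
have H0 x : (0 <= H x)%E by apply: nneseries_ge0 => k _ _; exact: term0.
have ndH x y : x <= y -> (H x <= H y)%E.
  move=> xy; apply: lee_nneseries => [k _ _|k _]; first exact: term0.
  rewrite lee_pmul2l ?lte_fin//; apply: le_measure.
  - by rewrite inE; exact: mUx.
  - by rewrite inE; exact: mUx.
  - move=> z [Uz] /=; rewrite !in_itv /= => /andP[az zx]; split => //.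
    by rewrite az (le_trans zx).
have Hb : (H b <= (\int[mu]_(x in `[a, b]) u x + eta * (b - a) + eta)%:E)%E.
  apply: le_trans HU _; rewrite [mu `[a, b]%classic](muab a b ab).
  rewrite -EFinM [leRHS]EFinD [X in (_ <= X + _)%E]EFinD /Rintegral fineK//.
  exact: integrable_fin_num.
have Hfin x : x <= b -> H x \is a fin_num.
  move=> xb; rewrite ge0_fin_numE//; apply: le_lt_trans (ndH _ _ xb) _.
  by apply: le_lt_trans Hb _; rewrite ltry.
pose G x := fine (H x) + eta * x.
apply: (@le_trans _ _ (G b - G a)); last first.
  have : fine (H b) <= \int[mu]_(x in `[a, b]) u x + eta * (b - a) + eta.
    by rewrite -lee_fin fineK// Hfin.
  have : 0 <= fine (H a) by rewrite fine_ge0.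
  rewrite /G; move: (fine (H a)) (fine (H b)) (\int[mu]_(x in `[a, b]) u x).
  by clear; move=> x y z; lra.
apply: increment_le_local => //.
- by move=> x _; apply/differentiable_continuous/derivable1_diffP.
- move=> x y; rewrite !in_itv /= => /andP[_ xb] /andP[_ yb] xy.
  rewrite /G lerD//; last by rewrite ler_pM2l.
  by apply: fine_le; [exact: Hfin|exact: Hfin|exact: ndH].
move=> s /andP[sa sb].
have sab : a <= s <= b by rewrite sa ltW.
have [K uK ltK] := minimal_multiple eta0 (u0 s sab).
have [d d0 dU] : exists2 d : R, 0 < d & forall k, (k < K)%N -> ball s d `<=` U k.
  elim: K ltK {uK} => [|K IHK] ltK; first by exists 1.
  have [k kK|d d0 dU] := IHK; first by apply: ltK; exact: ltnW.
  have : nbhs s (U K).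
    apply: open_nbhs_nbhs; split; first exact: oU.
    by apply: uU; [rewrite Dab|exact: ltK].
  move=> /nbhs_ballP[r /= r0 rU].
  exists (Num.min d r); first by rewrite lt_min d0.
  move=> k; rewrite ltnS leq_eqVlt => /predU1P[->|kK].
    by apply: subset_trans rU; apply: le_ball; rewrite ge_min lexx orbT.
  by apply: subset_trans (dU _ kK); apply: le_ball; rewrite ge_min lexx.
(* This slope is the one granted by the first K covers and the term eta * x. *)
have fc : 'D_1 f s < K%:R * eta + eta.
  by have := fu s sab; lra.
have mind : 0 < Num.min d (b - s) by rewrite lt_min d0 subr_gt0.
have [h /andP[h0]] := derivable_right_step (df s) fc mind.
rewrite lt_min => /andP[hd hb] fh.
exists (s + h); first by lra.
apply: le_trans fh _.
suff : (H s + (K%:R * eta * h)%R%:E <= H (s + h)%R)%E.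
  have ysb : s + h <= b by lra.
  rewrite -(fineK (Hfin _ (ltW sb))) -(fineK (Hfin _ ysb)) -EFinD lee_fin /G.
  lra.
have -> : ((K%:R * eta * h)%R%:E = \sum_(0 <= k < K) (eta * h)%R%:E)%E.
  by rewrite sumEFin sumr_const_nat subn0 -mulrA mulr_natl.
apply: (@le_trans _ _ (H s + \sum_(k <oo) (if (k < K)%N then (eta * h)%R%:E else 0))%E).
  rewrite leeD2l// (eq_big_nat _ _ (F2 := fun k => if (k < K)%N then (eta * h)%R%:E else 0)%E).
    apply: nneseries_lim_ge => k _ _; case: ifP => // _.
    by rewrite lee_fin mulr_ge0// ltW.
  by move=> k /andP[_ ->].
rewrite -nneseriesD; last 2 first.
- by move=> k _ _; exact: term0.
- by move=> k _ _; case: ifP => // _; rewrite lee_fin mulr_ge0// ltW.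
apply: lee_nneseries => [k _ _|k _].
  by rewrite adde_ge0//; case: ifP => // _; rewrite lee_fin mulr_ge0// ltW.
have sub1 : U k `&` `[a, s] `<=` U k `&` `[a, s + h].
  move=> z [Uz] /=; rewrite !in_itv /= => /andP[az zs]; split => //.
  by rewrite az; lra.
case: ifPn => [kK|_]; last first.
  rewrite adde0 lee_pmul2l ?lte_fin//; apply: le_measure => //.
  - by rewrite inE; exact: mUx.
  - by rewrite inE; exact: mUx.
rewrite EFinM -muleDr//; last by rewrite fin_num_adde_defl.
rewrite lee_pmul2l ?lte_fin//.
have -> : h%:E = mu `]s, s + h].
  rewrite lebesgue_measure_itv /= lte_fin ltrDl h0 -EFinB; congr EFin; ring.
have mI : measurable `]s, s + h]%classic by exact: measurable_itv.
rewrite -measureU; first last.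
- apply/seteqP; split => z //= [[_]]; rewrite !in_itv /= => /andP[_ zs].
  by rewrite ltNge zs.
- exact: mI.
- exact: mUx.
apply: le_measure.
- by rewrite inE; apply: measurableU; [exact: mUx|exact: mI].
- by rewrite inE; exact: mUx.
move=> z [/sub1//|]; rewrite /= !in_itv /= => /andP[sz zh]; split.
  apply: (dU _ kK); rewrite /ball /= ltr_distlC; lra.
by rewrite zh (le_trans sa (ltW sz)).
Qed.

(** The truncated derivative max (f', - N) becomes nonnegative once N is added
to it, which amounts to adding N x to f; then N tends to infinity. *)
Lemma derivable_le_Rintegral f a b : a <= b -> (forall x, derivable f x 1) ->
  mu.-integrable `[a, b] (EFin \o 'D_1 f) ->
  f b - f a <= \int[mu]_(x in `[a, b]) 'D_1 f x.
Proof.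
move=> ab df fi; set f' := 'D_1 f in fi *.
have /measurable_EFinP mf' := measurable_int _ fi.
have mD : measurable (`[a, b]%classic : set R) by exact: measurable_itv.
pose F (N : nat) (x : R) : R := Num.max (f' x) (- N%:R).
have mF N : measurable_fun `[a, b] (F N) by exact: measurable_maxr.
(* Truncating from below at a nonpositive level moves values towards 0. *)
have leF N x : `|F N x| <= `|f' x|.
  have N0 : 0 <= N%:R :> R by [].
  rewrite /F; case: (leP (f' x) (- N%:R)) => // fN.
  rewrite normrN ger0_norm// ler0_norm; lra.
have Fi N : mu.-integrable `[a, b] (EFin \o F N).
  apply: le_integrable fi => //; first by apply/measurable_EFinP; exact: mF.
  by move=> x _; rewrite lee_fin.
have cvgF : (fun N => \int[mu]_(x in `[a, b]) F N x) @ \oo -->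
    \int[mu]_(x in `[a, b]) f' x.
  apply: (@dominated_Rintegral _ _ _ mu _ F f' (fun x => `|f' x|)) => //.
    move=> x _; apply: cvg_near_cst; near=> N.
    rewrite /F; apply/max_idPl.
    have : - f' x <= N%:R by near: N; exact: nbhs_infty_ger.
    lra.
  exact: (integrable_abse fi).
apply: (cvgr_to_ge cvgF); apply: nearW => N.
have c_i (c : R) : mu.-integrable `[a, b] (EFin \o (fun=> c)).
  by apply: continuous_itv_integrable => x; exact: cvg_cst.
have dfN (x : R) : is_derive x 1 (fun x : R => f x + N%:R * x) (f' x + N%:R).
  have Dx : is_derive x 1 (fun x : R => N%:R * x) (N%:R : R).
    by have := is_deriveZ N%:R (is_derive_id x (1 : R)); rewrite [_ *: 1]mulr1.
  exact: (is_deriveD (derivableP (df x)) Dx).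
have := @derivable_le_integral (fun x => f x + N%:R * x)
  (fun x => F N x + N%:R) a b ab (fun x => @ex_derive _ _ _ _ _ _ _ (dfN x)).
rewrite RintegralD// Rintegral_cst//.
have -> : fine (mu `[a, b]) = b - a.
  rewrite lebesgue_measure_itv /= lte_fin; case: ltgtP ab => // -> _.
  by rewrite subrr.
have -> : f b + N%:R * b - (f a + N%:R * a) = f b - f a + N%:R * (b - a) by ring.
rewrite lerD2r; apply.
- move=> x _; rewrite (@derive_val _ _ _ _ _ _ _ (dfN x)) lerD2r.
  by rewrite /F le_max lexx.
- by move=> x _; rewrite -lerBlDr sub0r /F le_max lexx orbT.
- exact: integrable_EFinD.
Unshelve. all: by end_near. Qed.

(** The inequality for f and for - f. *)
Lemma FTC_derivable f a b : a <= b -> (forall x, derivable f x 1) ->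
  mu.-integrable `[a, b] (EFin \o 'D_1 f) ->
  \int[mu]_(x in `[a, b]) 'D_1 f x = f b - f a.
Proof.
move=> ab df fi; apply/eqP; rewrite eq_le derivable_le_Rintegral// andbT.
have DN x : 'D_1 (- f) x = - 'D_1 f x by rewrite deriveN.
have := @derivable_le_Rintegral (- f) a b ab (fun x => derivableN (df x)).
rewrite (_ : EFin \o 'D_1 (- f) = EFin \o (fun x => -1 * 'D_1 f x)); last first.
  by apply/funext => x /=; rewrite DN mulN1r.
move=> /(_ (integrable_EFinZ _ _ fi)).
under eq_Rintegral do rewrite DN -mulN1r.
rewrite RintegralZl// -[(- f) b]/(- f b) -[(- f) a]/(- f a).
by rewrite mulN1r -opprD lerN2; apply; exact: measurable_itv.
Qed.

End EverywhereDerivable.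

(** * The transform, translations and convolutions *)

Section Fourier.
Context {R : realType} {n : nat}.
Local Notation mu := (@lebesgue_measure R).
Local Notation T := (tensC R n).
Implicit Types (f g : R -> R) (w : 'rV[R]_n.+1).

(** The kernel exp(- omega t) of the transform. *)
Definition hkernel w (t : R) : T := texp (t *: - homega w).

Lemma hkernel0 w : hkernel w 0 = 1.
Proof. by rewrite /hkernel scale0r texp0. Qed.

Lemma hkernelD w s t : hkernel w (s + t) = hkernel w s * hkernel w t.
Proof. exact: texpD. Qed.

Lemma hkernel_continuous w p : continuous (fun t => hkernel w t p).
Proof. exact: texp_continuous. Qed.

Lemma hkernel_measurable w p : measurable_fun setT (fun t => hkernel w t p).
Proof. exact: continuous_measurable_fun (@hkernel_continuous w p). Qed.

Lemma hkernel_le1 w t p : `|hkernel w t p| <= 1.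
Proof. by rewrite /hkernel scalerN -scaleNr texp_homega_le1. Qed.

Lemma integrable_hkernel f w p : mu.-integrable setT (EFin \o f) ->
  mu.-integrable setT (EFin \o (fun t => f t * hkernel w t p)).
Proof.
move=> fi; apply: (@integrableM_bnd _ _ _ mu _ _ _ 1) => //.
- exact: hkernel_measurable.
- by move=> t _; exact: hkernel_le1.
Qed.

Lemma hfourierE f w p : hfourier f w p = \int[mu]_t (f t * hkernel w t p).
Proof.
rewrite /hfourier /tintegral ffunE; apply: eq_Rintegral => t _.
by rewrite tscaleE /hkernel scalerN.
Qed.

Lemma hfourier_shift f w (a : R) : mu.-integrable setT (EFin \o f) ->
  hfourier (fun t => f (t + a)) w = hkernel w (- a) * hfourier f w.
Proof.
move=> fi; apply/ffunP => r; rewrite hfourierE tmul_pairE.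
pose h y := f y * hkernel w (y - a) r.
have hi : mu.-integrable setT (EFin \o h).
  apply: (@integrableM_bnd _ _ _ mu _ _ _ 1) => //.
    apply: (measurableT_comp (@hkernel_measurable w r)).
    exact: measurable_funD.
  by move=> t _; exact: hkernel_le1.
transitivity (\int[mu]_t h (t + a)).
  by apply: eq_Rintegral => t _; rewrite /h addrK.
rewrite (Rintegral_shift a hi).
transitivity (\int[mu]_y (\sum_(k | addx k.1 k.2 == r)
    tsign k.1 k.2 * hkernel w (- a) k.1 * (f y * hkernel w y k.2))).
  apply: eq_Rintegral => y _; rewrite /h addrC hkernelD tmul_pairE mulr_sumr.
  by apply: eq_bigr => k _; rewrite mulrCA.
rewrite Rintegral_sum// => [|k _]; last first.
  by apply: integrable_EFinZ => //; exact: integrable_hkernel.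
apply: eq_bigr => k _; rewrite RintegralZl//; last exact: integrable_hkernel.
by rewrite hfourierE.
Qed.

Lemma hfourierZD f g w (a : R) : mu.-integrable setT (EFin \o f) ->
  mu.-integrable setT (EFin \o g) ->
  hfourier (a *: f + g) w = a *: hfourier f w + hfourier g w.
Proof.
move=> fi gi; apply/ffunP => p; rewrite [RHS]taddE [X in _ = X + _]tscaleE 3!hfourierE.
rewrite -RintegralZl//; last exact: integrable_hkernel.
have ki := integrable_hkernel w p fi; have li := integrable_hkernel w p gi.
rewrite -RintegralD//; last exact: integrable_EFinZ.
by apply: eq_Rintegral => t _; rewrite mulrA -mulrDl.
Qed.

Lemma integrable_convolution_kernel f g (k : R * R -> R) C :
  mu.-integrable setT (EFin \o f) -> mu.-integrable setT (EFin \o g) ->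
  measurable_fun setT k -> (forall z, `|k z| <= C) ->
  (mu \x mu)%E.-integrable setT (EFin \o (fun z => f z.1 * g (z.2 - z.1) * k z)).
Proof. by move=> fi gi; apply: (integrable_skew (s := -%R)) => //. Qed.

Lemma integrable_convolution_prod f g :
  mu.-integrable setT (EFin \o f) -> mu.-integrable setT (EFin \o g) ->
  (mu \x mu)%E.-integrable setT (EFin \o (fun z => f z.1 * g (z.2 - z.1))).
Proof.
move=> fi gi.
rewrite (_ : (fun z => _) = (fun z => f z.1 * g (z.2 - z.1) * cst 1 z)).
  apply: (@integrable_convolution_kernel _ _ _ 1) => //.
  by move=> z; rewrite normr1.
by apply/funext => z; rewrite mulr1.
Qed.

Lemma integrable_convolution f g : mu.-integrable setT (EFin \o f) ->
  mu.-integrable setT (EFin \o g) ->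
  mu.-integrable setT (EFin \o convolution f g).
Proof.
move=> fi gi; exact: integrable_Rfubini2 (integrable_convolution_prod fi gi).
Qed.

Lemma hfourier_convolution f g w : mu.-integrable setT (EFin \o f) ->
  mu.-integrable setT (EFin \o g) ->
  hfourier (convolution f g) w = hfourier f w * hfourier g w.
Proof.
move=> fi gi; apply/ffunP => r; rewrite hfourierE.
pose k (z : R * R) := hkernel w z.2 r.
have mk : measurable_fun setT k.
  exact: (measurableT_comp (@hkernel_measurable w r) measurable_snd).
have := @integrable_convolution_kernel f g k 1 fi gi mk
  (fun z => hkernel_le1 w z.2 r).
set K := (fun z => _) => Ki.
have ci := integrable_convolution fi gi.
(* The factor e(x) enters the inner integral only where the latter converges,
   hence for almost every x. *)
transitivity (\int[mu]_x \int[mu]_t K (t, x)).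
  apply: ae_eq_Rintegral => //.
  - have /measurable_EFinP := measurable_int _ (integrable_hkernel w r ci); exact.
  - by have /measurable_EFinP := measurable_int _ (integrable_Rfubini2 Ki).
  - have := ae_integrable2 (integrable_convolution_prod fi gi).
    by apply: filterS => x fgi _; rewrite /convolution -RintegralZr.
rewrite -(Rfubini Ki) tmul_pairE.
transitivity (\int[mu]_t (\sum_(k | addx k.1 k.2 == r)
    tsign k.1 k.2 * hfourier g w k.2 * (f t * hkernel w t k.1))).
  apply: eq_Rintegral => t _.
  transitivity (f t * hfourier (fun x => g (x - t)) w r).
    rewrite hfourierE -RintegralZl; first 1 last.
    - exact: measurableT.
    - by apply: integrable_hkernel; exact: integrable_shift.
    - by apply: eq_Rintegral => x _; rewrite /K /k /= -mulrA.
  rewrite hfourier_shift// opprK tmul_pairE mulr_sumr.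
  by apply: eq_bigr => q _; rewrite mulrAC mulrCA.
rewrite Rintegral_sum// => [|q _]; last first.
  by apply: integrable_EFinZ => //; exact: integrable_hkernel.
apply: eq_bigr => q _; rewrite RintegralZl//; last exact: integrable_hkernel.
by rewrite -hfourierE mulrAC.
Qed.

End Fourier.

(** * The transform of a derivative *)

Section Derivatives.
Context {R : realType} {n : nat}.
Local Notation mu := (@lebesgue_measure R).
Local Notation T := (tensC R n).
Implicit Types (f g : R -> R) (w : 'rV[R]_n.+1) (h : R).

(** Convolution with this function integrates over [t, t + h], not over
[t - h, t]: hence the support to the left of 0. *)
Definition box h : R -> R := \1_`[- h, 0].

Lemma integrable_box h : mu.-integrable setT (EFin \o box h).
Proof. exact: integrable_indic_itv. Qed.

Lemma hfourier_boxE h w p :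
  hfourier (box h) w p = \int[mu]_(t in `[- h, 0]) hkernel w t p.
Proof.
rewrite hfourierE [RHS]Rintegral_mkcond; apply: eq_Rintegral => t _.
by rewrite /box indicE patchE; case: ifP => _; rewrite ?mul1r ?mul0r.
Qed.

Lemma integrable_itv_hkernel w p a b :
  mu.-integrable `[a, b] (EFin \o (fun t => hkernel w t p)).
Proof. exact: continuous_itv_integrable (@hkernel_continuous _ _ w p). Qed.

Lemma is_derive_hkernel w (t : R) p :
  is_derive t 1 (fun t : R => hkernel w t p) ((- homega w * hkernel w t) p).
Proof. exact: is_tderive_texp. Qed.

(** The kernel is an antiderivative of - omega times itself. *)
Lemma homega_hfourier_box h w : 0 <= h ->
  homega w * hfourier (box h) w = hkernel w (- h) - 1.
Proof.
move=> h0; apply/ffunP => r; rewrite tmul_pairE.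
transitivity (\int[mu]_(t in `[- h, 0]) (\sum_(k | addx k.1 k.2 == r)
    tsign k.1 k.2 * homega w k.1 * hkernel w t k.2)).
  rewrite Rintegral_sum => [|//|k _]; last first.
    by apply: integrable_EFinZ => //; exact: integrable_itv_hkernel.
  apply: eq_bigr => k _; rewrite hfourier_boxE RintegralZl//.
  exact: integrable_itv_hkernel.
pose E (t : R) := hkernel w t r.
have dE (t : R) : 'D_1 E t = - (homega w * hkernel w t) r.
  by rewrite (@derive_val _ _ _ _ _ _ _ (is_derive_hkernel w t r)) mulNr toppE.
have E1 (t : R) : derivable E t 1.
  exact: (@ex_derive _ _ _ _ _ _ _ (is_derive_hkernel w t r)).
pose S (t : R) := \sum_(k | addx k.1 k.2 == r)
    tsign k.1 k.2 * homega w k.1 * hkernel w t k.2.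
have dEE : 'D_1 E = fun t => -1 * S t.
  by apply/funext => t; rewrite dE mulN1r tmul_pairE.
have Si : mu.-integrable `[- h, 0] (EFin \o S).
  apply: integrable_EFin_sum => // k _.
  by apply: integrable_EFinZ => //; exact: integrable_itv_hkernel.
have NSi : mu.-integrable `[- h, 0] (EFin \o (fun t => -1 * S t)).
  exact: integrable_EFinZ.
have := @FTC_derivable R E (- h) 0 _ E1.
rewrite dEE oppr_le0 => /(_ h0 NSi).
rewrite RintegralZl// mulN1r => /(congr1 -%R); rewrite opprK opprB => ->.
by rewrite taddE toppE /E hkernel0.
Qed.

Definition fwd_diff h f : R -> R := fun t => f (t + h) - f t.

(** This is the fundamental theorem of calculus on [t, t + h]. *)
Lemma convolution_box h g : 0 <= h -> (forall x, derivable g x 1) ->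
  mu.-integrable setT (EFin \o 'D_1 g) ->
  convolution ('D_1 g) (box h) = fwd_diff h g.
Proof.
move=> h0 dg gi; apply/funext => t; rewrite /convolution /fwd_diff.
rewrite -FTC_derivable ?lerDl//; last first.
  by apply: integrableS gi => //; exact: measurable_itv.
rewrite [RHS]Rintegral_mkcond; apply: eq_Rintegral => s _.
rewrite /box indicE patchE.
have -> : (t - s \in `[- h, 0]%classic) = (s \in `[t, t + h]%classic).
  by apply/idP/idP; rewrite !inE /= !in_itv /=; lra.
by case: ifP => _; rewrite ?mulr1 ?mulr0.
Qed.

Lemma is_derive_fwd_diff h g (x : R) : (forall x, derivable g x 1) ->
  is_derive x 1 (fwd_diff h g) (fwd_diff h ('D_1 g) x).
Proof.
move=> dg.
have Ds : is_derive x 1 (shift h) (1 : R) by exact: is_derive_shift.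
have := is_deriveB (is_derive1_comp (derivableP (dg (shift h x))) Ds) (derivableP (dg x)).
by rewrite mulr1.
Qed.

Lemma derive_iter_fwd_diff h i g : (forall x, derivable g x 1) ->
  (forall x, derivable (iter i (fwd_diff h) g) x 1) /\
  'D_1 (iter i (fwd_diff h) g) = iter i (fwd_diff h) ('D_1 g).
Proof.
move=> dg; elim: i => [//|i [IHd IHE]] /=; split=> [x|].
  exact: (@ex_derive _ _ _ _ _ _ _ (is_derive_fwd_diff h x IHd)).
by apply/funext => x; rewrite (@derive_val _ _ _ _ _ _ _ (is_derive_fwd_diff h x IHd)) IHE.
Qed.

Lemma integrable_fwd_diff h f : mu.-integrable setT (EFin \o f) ->
  mu.-integrable setT (EFin \o fwd_diff h f).
Proof.
move=> fi; rewrite (_ : fwd_diff h f = fun t => f (t + h) + -1 * f t); last first.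
  by apply/funext => t; rewrite mulN1r.
by apply: integrable_EFinD => //; [exact: integrable_shift|exact: integrable_EFinZ].
Qed.

Lemma hfourier_fwd_diff h f w : mu.-integrable setT (EFin \o f) ->
  hfourier (fwd_diff h f) w = (hkernel w (- h) - 1) * hfourier f w.
Proof.
move=> fi; rewrite mulrBl mul1r -hfourier_shift//.
have -> : fwd_diff h f = -1 *: f + (fun t => f (t + h)).
  by apply/funext => t; rewrite /fwd_diff addrC -[f t]mul1r -mulNr.
by rewrite hfourierZD//; [rewrite scaleN1r addrC|exact: integrable_shift].
Qed.

Lemma hfourier_iter_fwd_diff h i f w : mu.-integrable setT (EFin \o f) ->
  mu.-integrable setT (EFin \o iter i (fwd_diff h) f) /\
  hfourier (iter i (fwd_diff h) f) w = (hkernel w (- h) - 1) ^+ i * hfourier f w.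
Proof.
move=> fi; elim: i => [|i [IHi IHE]]; first by split=> //; rewrite expr0 [RHS]mul1r.
rewrite iterS; split; first exact: integrable_fwd_diff.
by rewrite hfourier_fwd_diff; [rewrite IHE exprS mulrA|exact: IHi].
Qed.

(** Each step trades one derivative for one difference and, being a
convolution with an integrable function, preserves integrability: the induction
only meets iterated differences of the intermediate derivatives, which are
integrable, and not these derivatives themselves. *)
Lemma hfourier_iter_fwd_diff_derive k f h w i : 0 <= h -> times_differentiable k f ->
  mu.-integrable setT (EFin \o (f^`(k))%classic) -> (i <= k)%N ->
  mu.-integrable setT (EFin \o iter i (fwd_diff h) (f^`(k - i))%classic) /\
  hfourier (iter i (fwd_diff h) (f^`(k - i))%classic) w =
    hfourier (box h) w ^+ i * hfourier (f^`(k))%classic w.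
Proof.
move=> h0 df fki; elim: i => [_|i IHi ik].
  by rewrite subn0; split=> //; rewrite expr0 [RHS]mul1r.
have [ui uE] := IHi (ltnW ik).
set g := (f^`(k - i.+1))%classic.
have dg (x : R) : derivable g x 1 by apply: df; rewrite ltn_subrL (leq_ltn_trans _ ik).
have [dw Dw] := derive_iter_fwd_diff h i dg.
have gE : 'D_1 g = (f^`(k - i))%classic.
  by apply/funext => x; rewrite -derive1E -derive1nS -subSn.
rewrite gE in Dw.
rewrite iterS -(convolution_box h0 dw) Dw//; split.
  by apply: integrable_convolution => //; exact: integrable_box.
rewrite hfourier_convolution; [|exact: ui|exact: integrable_box].
by rewrite uE exprS mulrC mulrA.
Qed.

Definition tcvg (u : nat -> T) (l : T) := forall p, (fun N => u N p) @ \oo --> l p.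

Lemma tcvgM (u v : nat -> T) (l m : T) : tcvg u l -> tcvg v m ->
  tcvg (fun N => u N * v N) (l * m).
Proof.
move=> ul vm r.
rewrite (_ : (fun N => _) = fun N => \sum_(k | addx k.1 k.2 == r)
    tsign k.1 k.2 * u N k.1 * v N k.2); last by apply/funext => N; rewrite tmul_pairE.
rewrite tmul_pairE; apply: cvg_fsum => k _; apply: cvgM (vm k.2).
by apply: cvgMl_tmp; exact: ul.
Qed.

(** Means of the kernel over shrinking intervals at 0 tend to its value there. *)
Lemma tcvg_box w :
  tcvg (fun N => N.+1%:R *: hfourier (box N.+1%:R^-1) w) 1.
Proof.
move=> p; apply/cvgrPdist_le => e e0.
have := @hkernel_continuous _ _ w p 0; rewrite /continuous_at hkernel0.
move=> /cvgrPdist_le /(_ _ e0)[d /= d0 ed].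
near=> N.
have hd : N.+1%:R^-1 < d by near: N; exact: (near_infty_natSinv_lt (PosNum d0)).
pose h : R := N.+1%:R^-1; have h0 : 0 < h by rewrite invr_gt0.
rewrite tscaleE hfourier_boxE -/h.
have NE : N.+1%:R = h^-1 by rewrite invrK.
have muh : fine (mu `[- h, 0]) = h.
  by rewrite lebesgue_measure_itv /= lte_fin oppr_lt0 h0 /= opprK add0r.
have ci (c : R) : mu.-integrable `[- h, 0] (EFin \o (fun=> c)).
  by apply: continuous_itv_integrable => x; exact: cvg_cst.
have -> : (1 : T) p = h^-1 * \int[mu]_(t in `[- h, 0]) ((1 : T) p).
  by rewrite Rintegral_cst// muh mulrCA mulVf ?mulr1// gt_eqF.
rewrite NE -mulrBr normrM gtr0_norm ?invr_gt0// mulrC ler_pdivrMr//.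
have ki := integrable_itv_hkernel w p (- h) 0.
rewrite -RintegralB; [|by []|exact: ci|exact: ki].
have di : mu.-integrable `[- h, 0] (EFin \o (fun t => (1 : T) p - hkernel w t p)).
  by apply: (integrableB _ (ci ((1 : T) p)) ki).
apply: le_trans (le_normr_Rintegral _ di) _ => //.
have -> : e * h = \int[mu]_(t in `[- h, 0]) e by rewrite Rintegral_cst// muh.
apply: le_Rintegral => //; first exact: (integrable_abse di).
move=> t; rewrite /= in_itv /= => /andP[ht t0].
by apply: ed; rewrite /= sub0r normrN ler0_norm// (le_lt_trans _ hd)// lerNl.
Unshelve. all: by end_near. Qed.

(** For every h > 0 the power a^k of the transform of the indicator kills the
difference of the two sides, and so does (a / h)^k, which tends to 1. *)
Theorem hfourier_derive1n k f w : times_differentiable k f ->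
  mu.-integrable setT (EFin \o f) ->
  mu.-integrable setT (EFin \o (f^`(k))%classic) ->
  hfourier (f^`(k))%classic w = homega w ^+ k * hfourier f w.
Proof.
move=> df fi fki.
pose z := homega w ^+ k * hfourier f w - hfourier (f^`(k))%classic w.
have az h : 0 <= h -> hfourier (box h) w ^+ k * z = 0.
  move=> h0.
  have [_ E1] := hfourier_iter_fwd_diff h k w fi.
  have [_] := hfourier_iter_fwd_diff_derive w h0 df fki (leqnn k).
  rewrite subnn E1 -homega_hfourier_box// exprMn => E2.
  by rewrite /z mulrBr -E2 mulrA [_ ^+ k * _ ^+ k]mulrC subrr.
apply/eqP; rewrite eq_sym -subr_eq0; apply/eqP; rewrite -/z.
have cz : tcvg (fun N => (N.+1%:R *: hfourier (box N.+1%:R^-1) w) ^+ k * z) z.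
  rewrite -[X in tcvg _ X](mul1r z) -[in X in tcvg _ X](expr1n _ k).
  apply: tcvgM => [|p]; last exact: cvg_cst.
  elim: k {df fki z az} => [p|k IHk]; first exact: cvg_cst.
  rewrite exprS (_ : (fun N => _) = fun N =>
     (N.+1%:R *: hfourier (box N.+1%:R^-1) w) *
     (N.+1%:R *: hfourier (box N.+1%:R^-1) w) ^+ k); last by apply/funext => N; rewrite exprS.
  by apply: tcvgM => //; exact: tcvg_box.
apply/ffunP => p; rewrite tzeroE; apply/esym/(cvg_unique _ _ (cz p)) => //.
rewrite (_ : (fun N => _) = fun=> 0); first exact: cvg_cst.
by apply/funext => N; rewrite exprZn -scalerAl az ?invr_ge0// scaler0 tzeroE.
Qed.

End Derivatives.

(** * Uniqueness of the cosine transform *)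

Section Uniqueness.
Context {R : realType}.
Local Notation mu := (@lebesgue_measure R).
Implicit Types (f g h : R -> R).

Lemma Rintegral_indicM (D : set R) g : \int[mu]_x (\1_D x * g x) = \int[mu]_(x in D) g x.
Proof.
rewrite [RHS]Rintegral_mkcond; apply: eq_Rintegral => x _.
by rewrite indicE patchE; case: ifP => _; rewrite ?mul1r ?mul0r.
Qed.

(** Bounded kernels over a strip: one variable carries an integrable function,
the other ranges over a compact interval. *)
Lemma Rfubini_kernel h g (k : R * R -> R) C a b :
  mu.-integrable setT (EFin \o h) -> continuous g ->
  measurable_fun setT k -> (forall z, `|k z| <= C) ->
  \int[mu]_t (h t * \int[mu]_(x in `[a, b]) (g x * k (t, x))) =
  \int[mu]_(x in `[a, b]) (g x * \int[mu]_t (h t * k (t, x))).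
Proof.
move=> hi cg mk kC.
have gi : mu.-integrable setT (EFin \o (fun x => \1_`[a, b] x * g x)).
  rewrite (_ : EFin \o _ = ((EFin \o g) \_ `[a, b]))%E.
    apply: (iffLR (integrable_mkcond _ _)) => //; exact: continuous_itv_integrable.
  apply/funext => x; rewrite /= indicE patchE.
  by case: ifP => _; rewrite ?mul1r ?mul0r.
have := @integrable_skew R h _ (cst 0) k C hi gi (measurable_cst _) mk kC.
set K := (fun z => _) => Ki.
have ki t : mu.-integrable setT (EFin \o (fun x => \1_`[a, b] x * g x * k (t, x))).
  apply: (@integrableM_bnd _ _ _ mu _ _ _ C) => //.
  exact: (measurableT_comp mk (measurable_pair1 t)).
have hki x : mu.-integrable setT (EFin \o (fun t => h t * k (t, x))).
  apply: (@integrableM_bnd _ _ _ mu _ _ _ C) => //.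
  exact: (measurableT_comp mk (measurable_pair2 x)).
have KE t x : K (t, x) = h t * (\1_`[a, b] x * g x * k (t, x)).
  by rewrite /K /= addr0 -!mulrA.
transitivity (\int[mu]_t \int[mu]_x K (t, x)).
  apply: eq_Rintegral => t _.
  under [RHS]eq_Rintegral do rewrite KE.
  rewrite RintegralZl//; congr (_ * _); rewrite -Rintegral_indicM.
  by apply: eq_Rintegral => x _; rewrite mulrA.
rewrite (Rfubini Ki) -Rintegral_indicM; apply: eq_Rintegral => x _.
rewrite mulrA -RintegralZl//; apply: eq_Rintegral => t _.
by rewrite KE mulrCA.
Qed.

(** Unnormalized density of the Cauchy distribution. *)
Definition cauchy_kernel (s : R) : R := (1 + s ^+ 2)^-1.

Lemma add1_sqr_gt0 s : 0 < 1 + s ^+ 2 :> R.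
Proof. by rewrite ltr_pwDl// sqr_ge0. Qed.

Lemma cauchy_kernel_continuous : continuous cauchy_kernel.
Proof.
move=> s; apply: cvgV; first by rewrite gt_eqF// add1_sqr_gt0.
apply: cvgD; first exact: cvg_cst.
exact: exprn_continuous.
Qed.

Lemma cauchy_kernel_le1 s : `|cauchy_kernel s| <= 1.
Proof.
rewrite /cauchy_kernel gtr0_norm ?invr_gt0 ?add1_sqr_gt0//.
by rewrite invf_le1 ?add1_sqr_gt0// lerDl sqr_ge0.
Qed.

Let expRN_continuous : continuous (fun x : R => expR (- x)).
Proof.
move=> x; apply: (@continuous_comp _ _ _ -%R expR); first exact: opp_continuous.
exact: continuous_expR.
Qed.

Lemma Rintegral_exp_cos (s N : R) : 0 <= N ->
  \int[mu]_(x in `[0, N]) (expR (- x) * cos (x * s)) =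
  (1 - expR (- N) * (cos (N * s) - s * sin (N * s))) * cauchy_kernel s.
Proof.
move=> N0; have s0 := gt_eqF (add1_sqr_gt0 s).
pose E (x : R) := cauchy_kernel s * (expR (- x) * (s * sin (x * s) - cos (x * s))).
have dE (x : R) : is_derive x 1 E (expR (- x) * cos (x * s)).
  have Dx : is_derive x 1 (fun x : R => x * s) s.
    have := is_deriveZ s (is_derive_id x (1 : R)).
    by rewrite [s *: 1]mulr1; congr is_derive; apply/funext => y /=; rewrite mulrC.
  have Dc := @is_derive1_comp _ cos (fun x => x * s) _ _ _ (is_derive_cos (x * s)) Dx.
  have Ds := @is_derive1_comp _ sin (fun x => x * s) _ _ _ (is_derive_sin (x * s)) Dx.
  have De := @is_derive1_comp _ expR -%R _ _ _ (is_derive_expR (- x)) (is_deriveNid x (1 : R)).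
  have := is_deriveZ (cauchy_kernel s) (is_deriveM De (is_deriveB (is_deriveZ s Ds) Dc)).
  move=> /is_derive_eq; apply; rewrite /GRing.scale /= /cauchy_kernel.
  rewrite -[(s \*: _ - _) x]/(s * sin (x * s) - cos (x * s)).
  by field; rewrite s0.
have EE : 'D_1 E = fun x => expR (- x) * cos (x * s).
  by apply/funext => x; rewrite (@derive_val _ _ _ _ _ _ _ (dE x)).
have dE1 (x : R) : derivable E x 1 by exact: (@ex_derive _ _ _ _ _ _ _ (dE x)).
have := @FTC_derivable R E 0 N N0 dE1; rewrite EE => -> //; last first.
  apply: continuous_itv_integrable => x; apply: cvgM.
    exact: expRN_continuous.
  have cs : continuous (fun y : R => cos (y * s)).
    move=> y; apply: (@continuous_comp _ _ _ (fun y : R => y * s) cos).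
      exact: mulrr_continuous.
    exact: continuous_cos.
  exact: cs.
rewrite /E !mul0r oppr0 expR0 sin0 cos0 /cauchy_kernel.
by field; rewrite s0.
Qed.

Lemma Rintegral_cauchy_kernel (M t a b : R) : 0 < M -> a <= b ->
  \int[mu]_(x in `[a, b]) cauchy_kernel (M * (x - t)) =
  (atan (M * (b - t)) - atan (M * (a - t))) / M.
Proof.
move=> M0 ab.
pose E (x : R) := M^-1 * atan (M * (x - t)).
have dE (x : R) : is_derive x 1 E (cauchy_kernel (M * (x - t))).
  have Dx : is_derive x 1 (fun x : R => M * (x - t)) M.
    have := is_deriveZ M (is_deriveB (is_derive_id x (1 : R)) (is_derive_cst t x (1 : R))).
    by rewrite subr0 [M *: 1]mulr1.
  have Da := @is_derive1_comp _ atan (fun x => M * (x - t)) _ _ _ (is_derive1_atan _) Dx.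
  have := is_deriveZ M^-1 Da.
  move=> /is_derive_eq; apply; rewrite /GRing.scale /= /cauchy_kernel.
  by rewrite mulrCA mulVf ?mulr1// gt_eqF.
have EE : 'D_1 E = fun x => cauchy_kernel (M * (x - t)).
  by apply/funext => x; rewrite (@derive_val _ _ _ _ _ _ _ (dE x)).
have dE1 (x : R) : derivable E x 1 by exact: (@ex_derive _ _ _ _ _ _ _ (dE x)).
have := @FTC_derivable R E a b ab dE1; rewrite EE => -> //.
  by rewrite /E -mulrBr mulrC.
apply: continuous_itv_integrable => x.
have ck : continuous (fun x : R => M * (x - t)).
  move=> y; apply: cvgMl_tmp; apply: cvgB; [exact: cvg_id|exact: cvg_cst].
apply: (@continuous_comp _ _ _ (fun x : R => M * (x - t)) cauchy_kernel); first exact: ck.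
exact: cauchy_kernel_continuous.
Qed.

Section Annihilator.
Variable h : R -> R.
Hypothesis hi : mu.-integrable setT (EFin \o h).
Hypothesis hcos : forall c x, \int[mu]_t (h t * cos (c * (x - t))) = 0.

Let mh : measurable_fun setT h.
Proof. by have /measurable_EFinP := measurable_int _ hi. Qed.

(** After an exchange of the integrals, the inner one is over t and vanishes
for each frequency y M. *)
Lemma annihilate_exp_cos (M x : R) (N : nat) :
  \int[mu]_t (h t * \int[mu]_(y in `[0, N%:R]) (expR (- y) * cos (y * (M * (x - t))))) = 0.
Proof.
have mk : measurable_fun setT (fun z : R * R => cos (z.2 * (M * (x - z.1)))).
  apply: (measurableT_comp (continuous_measurable_fun (@continuous_cos R))).
  apply: measurable_funM; first exact: measurable_snd.
  apply: measurable_funM => //; apply: measurable_funB => //.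
have := @Rfubini_kernel h _ _ 1 0 N%:R hi expRN_continuous mk (fun z => cos_max _).
rewrite /= => ->.
rewrite (eq_Rintegral _ (g := fun=> 0)) ?Rintegral_cst ?mul0r//.
move=> y _; under eq_Rintegral do rewrite mulrA.
by rewrite hcos mulr0.
Qed.

(** The integral of exp(- y) cos (y s) for y in [0, N] tends to 1 / (1 + s^2)
uniformly in s, with error at most 2 exp(- N). *)
Lemma annihilate_cauchy_kernel (M x : R) :
  \int[mu]_t (h t * cauchy_kernel (M * (x - t))) = 0.
Proof.
pose Q (N : nat) s : R := (1 - expR (- N%:R) * (cos (N%:R * s) - s * sin (N%:R * s)))
   * cauchy_kernel s.
have mQ N : measurable_fun setT (Q N).
  have mN : measurable_fun setT (fun s : R => N%:R * s) by exact: measurable_funM.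
  apply: measurable_funM; last first.
    exact: (continuous_measurable_fun cauchy_kernel_continuous).
  apply: measurable_funB => //; apply: measurable_funM => //.
  apply: measurable_funB.
    exact: (measurableT_comp (continuous_measurable_fun (@continuous_cos R)) mN).
  apply: measurable_funM => //.
  exact: (measurableT_comp (continuous_measurable_fun (@continuous_sin R)) mN).
have Q0 N : \int[mu]_t (h t * Q N (M * (x - t))) = 0.
  rewrite -[RHS](annihilate_exp_cos M x N); apply: eq_Rintegral => t _.
  by rewrite Rintegral_exp_cos.
have kb s : `|s| * cauchy_kernel s <= 1.
  rewrite ler_pdivrMr ?add1_sqr_gt0// mul1r.
  have := sqr_ge0 (`|s| - 1); rewrite sqrrB1 real_normK ?num_real//.
  have := normr_ge0 s; lra.
have ck0 s : 0 <= cauchy_kernel s by rewrite invr_ge0 ltW// add1_sqr_gt0.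
have ck1 s : cauchy_kernel s <= 1 by have := cauchy_kernel_le1 s; rewrite ger0_norm.
have trigb N s : `|cos (N%:R * s) - s * sin (N%:R * s)| <= 1 + `|s|.
  apply: le_trans (ler_normB _ _) _; apply: lerD; first exact: cos_max.
  by rewrite normrM ler_piMr// sin_max.
have Qck N s : `|Q N s - cauchy_kernel s| <= 2 * expR (- N%:R).
  rewrite /Q mulrBl mul1r addrAC subrr sub0r normrN !normrM [`|cauchy_kernel s|]ger0_norm//.
  rewrite [`|expR _|]ger0_norm ?expR_ge0// -mulrA mulrC ler_wpM2r ?expR_ge0//.
  apply: (@le_trans _ _ ((1 + `|s|) * cauchy_kernel s)).
    by apply: ler_wpM2r; [exact: ck0|exact: trigb].
  by rewrite mulrDl mul1r; have := ck1 s; have := kb s; lra.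
have cQ : (fun N => \int[mu]_t (h t * Q N (M * (x - t)))) @ \oo -->
    \int[mu]_t (h t * cauchy_kernel (M * (x - t))).
  apply: (@dominated_Rintegral _ _ _ mu _ _ _ (fun t => `|h t| * 3)) => //.
  - move=> N; apply: measurable_funM => //.
    apply: (measurableT_comp (mQ N)).
    by apply: measurable_funM => //; apply: measurable_funB.
  - move=> t _; apply: cvgMl_tmp; set s := M * _.
    apply/cvgrPdist_le => e e0; have e2 : 0 < e / 2 by rewrite divr_gt0.
    have /cvgr0_norm_lt /(_ _ e2) expN := @cvgn_expR R.
    near=> N.
    rewrite distrC; apply: le_trans (Qck N s) _.
    have : `|expR (- N%:R)| < e / 2 by near: N.
    rewrite ger0_norm ?expR_ge0//; lra.
  - apply: (integrableM_bnd (C := 3)) => //; first exact: (integrable_abse hi).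
    by move=> *; rewrite ger0_norm.
  - move=> N t _; rewrite normrM ler_wpM2l//; set s := M * _.
    have : expR (- N%:R) <= 1 :> R by rewrite expR_le1 oppr_le0.
    have := ler_normD (Q N s - cauchy_kernel s) (cauchy_kernel s).
    rewrite subrK; have := Qck N s; have := cauchy_kernel_le1 s; lra.
apply/esym/(cvg_unique _ _ cQ) => //.
by rewrite (_ : (fun N => _) = fun=> 0); [exact: cvg_cst|apply/funext => N].
Unshelve. all: by end_near. Qed.

(** The arctangent is an antiderivative of the Cauchy kernel. *)
Lemma annihilate_atan (M a b : R) : 0 < M -> a <= b ->
  \int[mu]_t (h t * (atan (M * (b - t)) - atan (M * (a - t)))) = 0.
Proof.
move=> M0 ab.
have mk : measurable_fun setT (fun z : R * R => cauchy_kernel (M * (z.2 - z.1))).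
  apply: (measurableT_comp (continuous_measurable_fun cauchy_kernel_continuous)).
  apply: measurable_funM => //; apply: measurable_funB; [exact: measurable_snd|].
  exact: measurable_fst.
have c1 : continuous (cst 1 : R -> R) by move=> x; exact: cvg_cst.
have := @Rfubini_kernel h (cst 1) _ 1 a b hi c1 mk
  (fun z => cauchy_kernel_le1 _).
rewrite /= [RHS](eq_Rintegral _ (g := fun=> 0)) => [|y _]; last first.
  by rewrite annihilate_cauchy_kernel mulr0.
rewrite Rintegral_cst// mul0r => /(congr1 ( *%R M)); rewrite mulr0 => <-.
have ai : mu.-integrable setT (EFin \o (fun t =>
    h t * (atan (M * (b - t)) - atan (M * (a - t))))).
  have ma c : measurable_fun setT (fun t : R => atan (M * (c - t))).
    apply: (measurableT_comp (continuous_measurable_fun (@continuous_atan R))).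
    by apply: measurable_funM => //; apply: measurable_funB.
  apply: (@integrableM_bnd _ _ _ mu _ _ _ pi) => //; first by apply: measurable_funB; exact: ma.
  move=> t _; have := atan_gtNpi2 (M * (b - t)); have := atan_ltpi2 (M * (b - t)).
  have := atan_gtNpi2 (M * (a - t)); have := atan_ltpi2 (M * (a - t)).
  by rewrite ler_norml; lra.
transitivity (M * \int[mu]_t (M^-1 * (h t * (atan (M * (b - t)) - atan (M * (a - t)))))).
  by rewrite RintegralZl// mulrA mulfV ?mul1r// gt_eqF.
congr (M * _); apply: eq_Rintegral => t _.
rewrite mulrCA; congr (h t * _).
rewrite mulrC -Rintegral_cauchy_kernel//.
by apply: eq_Rintegral => x _; rewrite mul1r.
Qed.

Lemma cvg_atan_step (c t : R) :
  (fun N : nat => atan (N.+1%:R * (c - t))) @ \oo -->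
    (pi / 2) * Num.sg (c - t).
Proof.
have gt0 (s : R) : 0 < s -> (fun N : nat => atan (N.+1%:R * s)) @ \oo --> (pi / 2 : R).
  move=> s0; apply: (@cvg_comp _ _ _ (fun N : nat => N.+1%:R * s) atan _ +oo%R).
    apply/cvgryPge => B; near=> N; rewrite -ler_pdivrMr//.
    rewrite -natr1 ler_wpDr//; near: N; exact: nbhs_infty_ger.
  exact: cvgy_atan.
have [s0|s0|->] := ltgtP (c - t) 0.
- rewrite ltr0_sg// mulrN1; under eq_fun do rewrite -[c - t]opprK mulrN atanN.
  by apply: cvgN; apply: gt0; rewrite oppr_gt0.
- by rewrite gtr0_sg// mulr1; exact: gt0.
- rewrite sgr0 mulr0; under eq_fun do rewrite mulr0 atan0; exact: cvg_cst.
Unshelve. all: by end_near. Qed.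

(** Dominated convergence for the arctangents dilated by N + 1: their
difference tends to pi in ]a, b[, to 0 outside [a, b] and to pi / 2 at the two
end points, which form a null set. *)
Lemma annihilate_itv a b : a < b -> \int[mu]_(t in `]a, b]) h t = 0.
Proof.
move=> ab.
have mh' := mh.
pose L (t : R) : R := (pi / 2) * Num.sg (b - t) - (pi / 2) * Num.sg (a - t).
pose A (N : nat) t := atan (N.+1%:R * (b - t)) - atan (N.+1%:R * (a - t)).
have mA N : measurable_fun setT (A N).
  have ma c : measurable_fun setT (fun t : R => atan (N.+1%:R * (c - t))).
    apply: (measurableT_comp (continuous_measurable_fun (@continuous_atan R))).
    by apply: measurable_funM => //; apply: measurable_funB.
  by apply: measurable_funB; exact: ma.
have AL t : (fun N => A N t) @ \oo --> L t by apply: cvgB; exact: cvg_atan_step.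
have mL : measurable_fun setT L.
  by apply: (measurable_fun_cvg mA) => t _; exact: AL.
have Api N t : `|A N t| <= pi.
  rewrite /A; set y := _ * (b - t); set z := _ * (a - t).
  have := atan_gtNpi2 y; have := atan_ltpi2 y.
  have := atan_gtNpi2 z; have := atan_ltpi2 z.
  by rewrite ler_norml; lra.
have Lpi t : `|L t| <= pi.
  by apply: (cvgr_to_le (cvg_norm (AL t))); apply: nearW => N; exact: Api.
have hLi : mu.-integrable setT (EFin \o (fun t => h t * L t)).
  by apply: (@integrableM_bnd _ _ _ mu _ _ _ pi).
have hL : \int[mu]_t (h t * L t) = 0.
  have cL : (fun N : nat => \int[mu]_t (h t * A N t)) @ \oo --> \int[mu]_t (h t * L t).
    apply: (@dominated_Rintegral _ _ _ mu _ _ _ (fun t => `|h t| * pi)) => //.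
    - by move=> N; apply: measurable_funM => //; exact: mA.
    - by move=> t _; apply: cvgMl_tmp; exact: AL.
    - apply: (integrableM_bnd (C := pi)) => //; first exact: (integrable_abse hi).
      by move=> *; rewrite ger0_norm// pi_ge0.
    - by move=> N t _; rewrite normrM ler_wpM2l.
  apply/esym/(cvg_unique _ _ cL) => //.
  rewrite (_ : (fun N => _) = fun=> 0); first exact: cvg_cst.
  by apply/funext => N; rewrite annihilate_atan// ltW.
have hio : mu.-integrable `]a, b[ (EFin \o h).
  by apply: integrableS hi => //; exact: measurable_itv.
have pi0 : pi != 0 :> R by rewrite gt_eqF ?pi_gt0.
apply: (mulfI pi0); rewrite mulr0 -hL -Rintegral_itv_bndo_bndc//.
rewrite -RintegralZl//.
have Lin t : a < t < b -> L t = pi.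
  move=> /andP[at_ tb]; rewrite /L gtr0_sg ?subr_gt0// ltr0_sg ?subr_lt0//; lra.
have Lout t : ~~ (a <= t <= b) -> L t = 0.
  rewrite /L negb_and -!ltNge => /orP[ta|bt].
    by rewrite !gtr0_sg ?subr_gt0 ?subrr// (lt_trans ta).
  by rewrite !ltr0_sg ?subr_lt0 ?subrr// (lt_trans ab).
transitivity (\int[mu]_(t in `]a, b[) (h t * L t)).
  apply: eq_Rintegral => t; rewrite inE /= in_itv /= => tab.
  by rewrite Lin// mulrC.
have hLD (D : interval R) : mu.-integrable [set` D] (EFin \o (fun t => h t * L t)).
  by apply: integrableS hLi => //; exact: measurable_itv.
rewrite Rintegral_itv_bndo_bndc; last exact: hLD.
rewrite Rintegral_itv_obnd_cbnd; last exact: hLD.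
rewrite Rintegral_mkcond; apply: eq_Rintegral => t _; rewrite patchE.
case: ifPn => //; rewrite notin_setE /= in_itv /= => /negP tab.
by rewrite Lout// mulr0.
Qed.

(** The integral of h up to x does not depend on x, and its derivative is h x
for almost every x. *)
Lemma annihilate_ae : {ae mu, forall t, h t = 0}.
Proof.
have locf : locally_integrable setT h by apply: open_integrable_locally => //; exact: openT.
have hy y : mu.-integrable `]-oo, y] (EFin \o h).
  by apply: integrableS hi => //; exact: measurable_itv.
have := FTC1Ny hy locf; apply: filterS; first exact: (ae_filter_ringOfSetsType mu).
move=> x /= [_ <-].
pose H y : R := \int[mu]_(t in `]-oo, y]) h t.
have Hlt a b : a < b -> H b = H a.
  move=> ab; apply/eqP; rewrite -subr_eq0 -(annihilate_itv ab) /H; apply/eqP.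
  by apply: Rintegral_itvB => //; rewrite bnd_simp ltW.
have -> : (fun y => \int[mu]_(t in `]-oo, y]) h t) = cst (H x).
  apply/funext => y; rewrite -/(H y) /cst.
  by have [/Hlt|/Hlt ->|->] := ltgtP x y.
by rewrite derive1_cst.
Qed.

End Annihilator.
End Uniqueness.

(** * The transform on the real line *)

(** At omega = c i_0 the kernel is cos (c t) - i_0 sin (c t), so two coordinates
of the transform are the cosine and sine transforms of h. *)
Lemma hfourier_eq0_cos (R : realType) (n : nat) (h : R -> R) :
  (@lebesgue_measure R).-integrable setT (EFin \o h) ->
  (forall w : 'rV[R]_n.+1, hfourier h w = 0 :> tensC R n) ->
  forall c x : R, \int[lebesgue_measure]_t (h t * cos (c * (x - t))) = 0.
Proof.
move=> hi h0 c x; pose w : 'rV[R]_n.+1 := \row_j (c *+ (j == ord0)).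
have wE : homega w = c *: ti ord0.
  rewrite /homega (bigD1 ord0)//= big1 ?addr0 ?mxE// => j /negbTE j0.
  by rewrite mxE j0 scale0r.
have kE t : hkernel w t = cos (c * t) *: 1 - sin (c * t) *: ti ord0.
  by rewrite /hkernel wE -scaleNr texp_ti mulNr cosN sinN scaleNr.
have e01 : expo0 == expo1 ord0 :> {ffun 'I_n.+1 -> bool} = false.
  by apply/eqP => /ffunP /(_ ord0); rewrite !ffunE eqxx.
have k0 t : hkernel w t expo0 = cos (c * t).
  by rewrite kE taddE toppE !tscaleE toneE eqxx mulr1 /ti /tbasis ffunE e01 mulr0 subr0.
have k1 t : hkernel w t (expo1 ord0) = - sin (c * t).
  rewrite kE taddE toppE !tscaleE toneE eq_sym e01 mulr0 add0r.
  by rewrite /ti /tbasis ffunE eqxx mulr1.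
have hk p : \int[lebesgue_measure]_t (h t * hkernel w t p) = 0.
  by rewrite -hfourierE h0 tzeroE.
pose I p t := h t * hkernel w t p.
have Ii p : (@lebesgue_measure R).-integrable setT (EFin \o I p).
  exact: integrable_hkernel.
transitivity (\int[lebesgue_measure]_t
    (cos (c * x) * I expo0 t + - sin (c * x) * I (expo1 ord0) t)).
  apply: eq_Rintegral => t _; rewrite /I k0 k1 mulrBr cosB; ring.
rewrite RintegralD//; [|exact: integrable_EFinZ..].
rewrite !RintegralZl// /I !hk; ring.
Qed.

Theorem theoremV2p2 (R : realType) (n : nat) :
  let mu := @lebesgue_measure R in
  let L1 := Lfun mu 1 in
  let F : (R -> R) -> 'rV[R]_n.+1 -> tensC R n := @hfourier R n in
  [/\ (* the integral exists, and depends only on the a.e. class of f *)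
      (forall f : R -> R, f \in L1 -> forall w p,
         (fun t : R => (f t *: texp (- (t *: homega w)) : tensC R n) p) \in L1)
      /\ (forall f g : R -> R, f \in L1 -> g \in L1 ->
           f = g %[ae mu] -> F f = F g),
      (* R-linearity *)
      forall (a : R) (f g : R -> R), f \in L1 -> g \in L1 ->
        F (a *: f + g) = a *: F f + F g,
      (* injectivity on a.e. classes *)
      forall f g : R -> R, f \in L1 -> g \in L1 ->
        F f = F g -> f = g %[ae mu],
      (* derivatives *)
      forall (k : nat) (f : R -> R), times_differentiable k f ->
        f \in L1 -> (f^`(k))%classic \in L1 ->
        forall w, F (f^`(k))%classic w = homega w ^+ k * F f w
    & (* convolutions *)
      forall f g : R -> R, f \in L1 -> g \in L1 ->
        convolution f g \in L1 /\
        forall w, F (convolution f g) w = F f w * F g w].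
Proof.
move=> mu L1 F.
have L1P f : f \in L1 -> mu.-integrable setT (EFin \o f) by move/Lfun1_integrable.
split.
- split=> [f /L1P fi w p|f g /L1P fi /L1P gi fg].
    apply/Lfun1_integrable; have := integrable_hkernel w p fi.
    congr (mu.-integrable _ _); apply/funext => t /=.
    by rewrite tscaleE /hkernel scalerN.
  apply/funext => w; apply/ffunP => p; rewrite /F 2!hfourierE.
  apply: ae_eq_Rintegral => //.
  + by have /measurable_EFinP := measurable_int _ (integrable_hkernel w p fi).
  + by have /measurable_EFinP := measurable_int _ (integrable_hkernel w p gi).
  + apply: filterS fg; first exact: (ae_filter_ringOfSetsType mu).
    by move=> t /(_ I) ->.
- by move=> a f g /L1P fi /L1P gi; apply/funext => w; exact: hfourierZD.
- move=> f g /L1P fi /L1P gi Ffg.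
  pose h := -1 *: g + f.
  have hi : mu.-integrable setT (EFin \o h).
    have := integrable_EFinD _ (integrable_EFinZ (-1) _ gi) fi.
    by apply.
  have h0 w : hfourier h w = 0 :> tensC R n.
    by rewrite (hfourierZD w (-1) gi fi) -[hfourier f w]/(F f w) Ffg scaleN1r addNr.
  have := annihilate_ae hi (hfourier_eq0_cos hi h0).
  apply: filterS; first exact: (ae_filter_ringOfSetsType mu).
  move=> t /= ht _; apply/eqP; rewrite -subr_eq0 -ht.
  by rewrite -[h t]/(-1 * g t + f t) mulN1r addrC.
- by move=> k f df /L1P fi /L1P fki w; exact: hfourier_derive1n.
- move=> f g /L1P fi /L1P gi; split.
    by apply/Lfun1_integrable; exact: integrable_convolution.
  by move=> w; exact: hfourier_convolution.
Qed.
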